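(* Let $F:\mathbb{R}^2\times\mathbb{R}^2\to\mathbb{R}$ satisfy, for all $p,q,q_1,q_2\in\mathbb{R}^2$: $F$ is continuous; $F(p,\theta q_1+(1-\theta)q_2)\le\theta F(p,q_1)+(1-\theta)F(p,q_2)$ for all $\theta\in[0,1]$; $F(p,\lambda q)=\lambda F(p,q)$ for all $\lambda>0$; there exist $m_1,m_2>0$ with $m_1|q|\le F(p,q)\le m_2|q|$; and $F(p+n,q)=F(p,q)$ for all $n\in\mathbb{Z}^2$. Then for every $\tau\in\mathbb{R}$ there exists a Lipschitz continuous $1$-periodic $u_\tau\in\mathcal{M}_\tau$ such that $\mathcal{F}(u_\tau)=S_F(\tau)$.
   Context: $W^{1,1}$ denotes the space of $u\in W^{1,1}_{loc}(\mathbb{R};\mathbb{R}^2)$ with $u(t+1)=u(t)$ for all $t$. For $u\in W^{1,1}$: $\mathcal{F}(u)=\int_0^1F(u,\dot u)\,dt$ and $\mathcal{A}(u)=\frac12\int_0^1u\cdot i\dot u\,dt$, where $\mathbb{R}^2\cong\mathbb{C}$ and $ip$ is the rotation of $p$ by $\pi/2$. $\mathcal{M}_\tau=\{u\in W^{1,1}:\mathcal{A}(u)=\tau\}$ and $S_F(\tau)=\inf_{v\in\mathcal{M}_\tau}\mathcal{F}(v)$. *)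

(* Defs.v *)
From HB Require Import structures.
From mathcomp Require Import all_boot all_order all_algebra.
From mathcomp Require Import all_classical all_reals all_analysis.
Set Implicit Arguments. Unset Strict Implicit. Unset Printing Implicit Defensive.
Import Order.TTheory GRing.Theory Num.Theory.
Import numFieldNormedType.Exports.
Local Open Scope classical_set_scope.
Local Open Scope ring_scope.

Section Defs.
Variable R : realType.
Local Notation mu := (@lebesgue_measure R).

Definition enorm (p : R * R) : R := Num.sqrt (p.1 ^+ 2 + p.2 ^+ 2).

(* u : R -> R^2 is 1-periodic and in W^{1,1}_loc with weak derivative v:
   v is integrable on every bounded interval and u is the indefinite integral
   of v, i.e. u(b) - u(a) = \int_a^b v  (componentwise). *)
Definition W11 (u v : R -> R * R) : Prop :=
  (forall t, u (t + 1) = u t) /\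
  forall a b : R, a <= b ->
    [/\ mu.-integrable `[a%R, b%R] (fun t => ((v t).1)%:E),
        mu.-integrable `[a%R, b%R] (fun t => ((v t).2)%:E),
        (((u b).1 - (u a).1)%:E = \int[mu]_(t in `[a%R, b%R]) ((v t).1)%:E)%E &
        (((u b).2 - (u a).2)%:E = \int[mu]_(t in `[a%R, b%R]) ((v t).2)%:E)%E].

Definition Fcal (F : R * R -> R * R -> R) (u v : R -> R * R) : \bar R :=
  (\int[mu]_(t in `[0%R, 1%R]) (F (u t) (v t))%:E)%E.

(* \mathcal A(u) = 1/2 \int_0^1 u . i\dot u dt, with i(a,b) = (-b,a) *)
Definition Acal (u v : R -> R * R) : \bar R :=
  (\int[mu]_(t in `[0%R, 1%R])
     ((2^-1 * ((u t).1 * - (v t).2 + (u t).2 * (v t).1)))%:E)%E.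

Definition SF (F : R * R -> R * R -> R) (tau : R) : \bar R :=
  ereal_inf [set x | exists u v, [/\ W11 u v, Acal u v = tau%:E & x = Fcal F u v]].

Definition lipschitz2 (u : R -> R * R) : Prop :=
  exists L : R, forall s t, enorm ((u s).1 - (u t).1, (u s).2 - (u t).2) <= L * `|s - t|.

End Defs.

(* Main.v *)
(**
Direct method, carried out on inscribed polygons.  Let [u] be a competitor of
energy [E].  Following [u] along the strictly increasing function
[t |-> \int_0^t F(u, u') + t] and sampling at [N] equidistant values gives
points [w(k/N)] where [w] is Lipschitz with a constant depending only on [E];
Jensen's inequality and the modulus of continuity of [F] bound the polygon
energy [\sum_k F(w(k/N), w((k+1)/N) - w(k/N))] by [(1 + e) E], and the area of
the polygon is within [O(1/N)] of the area of [u].  Both bounds only involve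
finitely many values of [w], so they survive pointwise limits along an
ultrafilter: a minimizing sequence (translated so that [u(0)] lies in the unit
square) yields a Lipschitz closed curve [W] satisfying them with [E] replaced
by the infimum.  Letting [N] tend to infinity, the area of [W] is [tau], and
since [W] is differentiable almost everywhere, Fatou's lemma gives that the
energy of [W] is at most the infimum.
*)
Require Import Defs.
From HB Require Import structures.
From mathcomp Require Import all_boot all_order all_algebra.
From mathcomp Require Import all_classical all_reals all_analysis.
From mathcomp Require Import measurable_realfun lra ring.
Import Order.TTheory GRing.Theory Num.Theory.
Import numFieldNormedType.Exports.
Local Open Scope classical_set_scope.
Local Open Scope ring_scope.
Set Implicit Arguments. Unset Strict Implicit. Unset Printing Implicit Defensive.

(** * Measurability and integrals on intervals *)

(** The obstacle is that a minimizing sequence is bounded only in $W^{1,1}$, where derivatives may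
    concentrate, while the area constraint must survive the limit. Hence estimates are phrased
    through values of curves. The polygon bounds are proved for $u$ itself on the arcs cut out by
    the inverse of the energy parameter, where its integral representation is available; $w$ enters
    through its values alone. Moving the base point of $F$ is controlled multiplicatively,
    $F(p,q)\le(1+e)F(p',q)$, because this form integrates directly to $(1+e)E$; the lower bound
    $m_1|q|$ turns the additive modulus of continuity into it. Convexity and homogeneity together
    make $F(p,\cdot)$ sublinear, so Jensen's inequality reduces to one supporting linear functional
    per arc. A pointwise limit carries no derivative. The derivative of $W$ is built from the
    Lipschitz bound by Radon-Nikodym, and it must agree almost everywhere with the pointwise slope,
    since Fatou's lemma is applied to difference quotients. *)

Lemma measurable_countable_comp d (T : measurableType d) d' (U : measurableType d')
  (Z : countType) (D : set T) (h : T -> Z) (G : Z -> U) :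
  (forall z, measurable (D `&` h @^-1` [set z])) ->
  measurable_fun D (G \o h).
Proof.
move=> mh mD Y mY.
have -> : D `&` (G \o h) @^-1` Y =
    \bigcup_(z in [set: Z]) (if G z \in Y then D `&` h @^-1` [set z] else set0).
  apply/seteqP; split => [t [Dt /= GY]|t [z _]].
    by exists (h t) => //; rewrite mem_set.
  by case: ifPn => // /set_mem GY [Dt /= ht]; split => //=; rewrite ht.
apply: countable_bigcupT_measurable => [|z]; first exact: countableP.
by case: ifPn.
Qed.

Lemma measurable_floor_fiber d (T : measurableType d) (R : realType)
  (D : set T) (x : T -> R) (c : R) (k : int) :
  measurable D -> measurable_fun D x ->
  measurable (D `&` [set t | Num.floor (c * x t) = k]).
Proof.
move=> mD mx.
have mcx : measurable_fun D (fun t => c * x t) by apply: measurable_funM.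
have -> : [set t | Num.floor (c * x t) = k] =
    (fun t => c * x t) @^-1` `[k%:~R, (k + 1)%:~R[%classic.
  apply/seteqP; split => t /=; rewrite in_itv /=.
    by move/eqP; rewrite floor_eq.
  by rewrite -floor_eq => /eqP.
exact: mcx.
Qed.

(** The mesh [1 / n.+1] avoids a division by zero at [n = 0]. Besides discretizing measurable
    functions, this gives the left node of the parameter interval of the polygon edge that contains
    [x]. *)
Definition grid_approx (R : realType) (n : nat) (x : R) : R :=
  (Num.floor (n.+1%:R * x))%:~R / n.+1%:R.

Lemma cvg_grid_approx (R : realType) (x : R) :
  grid_approx n x @[n --> \oo] --> x.
Proof.
apply/cvgrPdist_le => e e0.
near=> n.
have n0 : 0 < n.+1%:R :> R by rewrite ltr0n.
have /andP[h1 h2] := floor_itv (n.+1%:R * x).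
rewrite /grid_approx.
set k := (Num.floor _)%:~R in h1 *.
have h3 : n.+1%:R * x < k + 1 by rewrite (lt_le_trans h2)// intrD.
have ne : n.+1%:R^-1 <= e by apply: ltW; near: n; exact: (near_infty_natSinv_lt (PosNum e0)).
rewrite ler_norml; apply/andP; split.
  rewrite (@le_trans _ _ 0)//; first lra.
  by rewrite subr_ge0 ler_pdivrMr// mulrC.
apply: le_trans ne; rewrite lerBlDr -[X in _ <= X + _]mul1r -mulrDl ler_pdivlMr// mulrC.
by rewrite addrC ltW.
Unshelve. all: by end_near. Qed.

Lemma continuous_cvg4 (R : realType) (H : (R * R) * (R * R) -> R) (T : Type)
  (G : set_system T) (FG : Filter G) (a b c d : T -> R) (la lb lc ld : R) :
  continuous H -> a @ G --> la -> b @ G --> lb -> c @ G --> lc -> d @ G --> ld ->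
  H ((a t, b t), (c t, d t)) @[t --> G] --> H ((la, lb), (lc, ld)).
Proof.
move=> cH ca cb cc cd.
have cv : ((a t, b t), (c t, d t)) @[t --> G] --> ((la, lb), (lc, ld)).
  exact: (cvg_pair (cvg_pair ca cb) (cvg_pair cc cd)).
apply: (cvg_comp _ _ cv); exact: cH.
Qed.

(* [H] of the grid approximations takes countably many values; this avoids
   comparing the Borel sets of [R^4] with the product sigma-algebra. *)
Lemma measurable_continuous_comp4 d (T : measurableType d) (R : realType)
  (H : (R * R) * (R * R) -> R) (D : set T) (x1 x2 x3 x4 : T -> R) :
  measurable D -> continuous H ->
  measurable_fun D x1 -> measurable_fun D x2 ->
  measurable_fun D x3 -> measurable_fun D x4 ->
  measurable_fun D (fun t => H ((x1 t, x2 t), (x3 t, x4 t))).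
Proof.
move=> mD cH m1 m2 m3 m4.
pose g n t := H ((grid_approx n (x1 t), grid_approx n (x2 t)),
                 (grid_approx n (x3 t), grid_approx n (x4 t))).
apply: (@measurable_fun_cvg _ _ _ _ g) => [n|t Dt].
  pose fl x := Num.floor (n.+1%:R * x : R).
  pose h t := ((fl (x1 t), fl (x2 t)), (fl (x3 t), fl (x4 t))).
  pose b (k : int) : R := k%:~R / n.+1%:R.
  have -> : g n = (fun z => H ((b z.1.1, b z.1.2), (b z.2.1, b z.2.2))) \o h by [].
  apply: measurable_countable_comp => -[[k1 k2] [k3 k4]].
  have -> : D `&` h @^-1` [set (k1, k2, (k3, k4))] =
     (D `&` [set t | fl (x1 t) = k1]) `&` (D `&` [set t | fl (x2 t) = k2]) `&`
     ((D `&` [set t | fl (x3 t) = k3]) `&` (D `&` [set t | fl (x4 t) = k4])).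
    apply/seteqP; split => t.
      by case=> Dt [] <- <- <- <-.
    by case=> -[[Dt /= e1] [_ e2]] [[_ e3] [_ e4]]; split => //=; rewrite /h e1 e2 e3 e4.
  by do 2 apply: measurableI => //; exact: measurable_floor_fiber.
by apply: continuous_cvg4 => //; exact: cvg_grid_approx.
Qed.

Section indefinite.
Variable R : realType.
Local Notation mu := (@lebesgue_measure R).

Lemma integrable_itvS (f : R -> R) (a b c d : R) :
  a <= c -> d <= b -> mu.-integrable `[a, b] (EFin \o f) ->
  mu.-integrable `[c, d] (EFin \o f).
Proof.
move=> ac db; apply: integrableS => //.
by apply: subset_itv; rewrite bnd_simp.
Qed.

Lemma Rintegral_itv_split (f : R -> R) (a b c : R) :
  a <= b -> b <= c -> mu.-integrable `[a, c] (EFin \o f) ->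
  \int[mu]_(t in `[a, c]) f t =
  \int[mu]_(t in `[a, b]) f t + \int[mu]_(t in `[b, c]) f t.
Proof.
move=> ab bc fi.
have := @Rintegral_itvB _ f (BLeft a) (BRight c) b fi.
rewrite !bnd_simp => /(_ ab bc) h.
apply/eqP; rewrite addrC -subr_eq h; apply/eqP.
apply: Rintegral_itv_obnd_cbnd.
by apply: integrableS fi => //; apply: subset_itv; rewrite bnd_simp.
Qed.

Lemma Rintegral_itv_sum (f : R -> R) (N : nat) (a : nat -> R) :
  (forall k, (k < N)%N -> a k <= a k.+1) ->
  mu.-integrable `[a 0%N, a N] (EFin \o f) ->
  \int[mu]_(t in `[a 0%N, a N]) f t =
  \sum_(k < N) \int[mu]_(t in `[a k, a k.+1]) f t.
Proof.
elim: N => [|N IH] amono fi.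
  by rewrite big_ord0 set_itv1 Rintegral_set1.
have a0N : a 0%N <= a N.
  elim: (N) (fun k (h : (k < N)%N) => amono k (ltnW h)) => // M IHM h.
  apply: (@le_trans _ _ (a M)); last exact: h.
  by apply: IHM => k kM; apply: h; exact: ltnW.
have aNN := amono N (ltnSn N).
rewrite big_ord_recr/= (@Rintegral_itv_split _ _ (a N))//; congr (_ + _).
apply: IH => [k kN|]; first by apply: amono; exact: ltnW.
exact: integrable_itvS fi.
Qed.

Lemma Rintegral_EFin (f : R -> R) (a b : R) :
  mu.-integrable `[a, b] (EFin \o f) ->
  (\int[mu]_(t in `[a, b]) (f t)%:E = (\int[mu]_(t in `[a, b]) f t)%:E)%E.
Proof. by move=> fi; rewrite /Rintegral fineK//; exact: integrable_fin_num. Qed.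

Lemma Rintegral_itv_cst (a b c : R) : a <= b ->
  \int[mu]_(t in `[a, b]) c = c * (b - a).
Proof.
move=> ab; rewrite Rintegral_cst//; congr (c * _).
suff mE : fine (mu `[a, b]) = b - a by exact: mE.
rewrite lebesgue_measure_itv /= lte_fin; move: ab; rewrite le_eqVlt.
by move=> /predU1P[->|->//]; rewrite ltxx subrr.
Qed.

Lemma integrable_itv_cst (a b c : R) : mu.-integrable `[a, b] (EFin \o (fun=> c)).
Proof.
apply: continuous_compact_integrable; first exact: segment_compact.
by apply: continuous_subspaceT => t; exact: cvg_cst.
Qed.

End indefinite.

(** * Supporting functionals of sublinear functions on the plane *)

Lemma sublinear_subgradient (R : realType) (g : R -> R -> R) :
  (forall x y l, 0 < l -> g (l * x) (l * y) = l * g x y) ->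
  (forall x y x' y', g (x + x') (y + y') <= g x y + g x' y') ->
  forall x0 y0, exists a b : R,
    (forall x y, a * x + b * y <= g x y) /\ a * x0 + b * y0 = g x0 y0.
Proof.
move=> ghom gsub.
have g0 : g 0 0 = 0 by have := ghom 0 0 2 ltac:(lra); rewrite !mulr0; lra.
(* For negative [s] this is [0 = g 0 0 <= g (s z) + g (- s z)] with [z = (x, y)]: a linear function
   on a line that touches [g] on one ray stays below it on the other. *)
have glin s x y : s * g x y <= g (s * x) (s * y).
  have [s0|s0|->] := ltgtP s 0; last by rewrite !mul0r g0.
    have := gsub (s * x) (s * y) (- s * x) (- s * y).
    rewrite (ghom x y (- s)) ?oppr_gt0// !mulNr !subrr g0; lra.
  by rewrite ghom.
suff main x0 y0 : 0 < x0 ^+ 2 + y0 ^+ 2 -> exists a b : R,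
    (forall x y, a * x + b * y <= g x y) /\ a * x0 + b * y0 = g x0 y0.
  move=> x0 y0; have := addr_ge0 (sqr_ge0 x0) (sqr_ge0 y0).
  rewrite le_eqVlt => /predU1P[/esym/eqP|]; last exact: main.
  rewrite paddr_eq0 ?sqr_ge0// !sqrf_eq0 => /andP[/eqP -> /eqP ->].
  have [|a [b [h _]]] := main 1 0; first by rewrite expr1n expr0n/= addr0.
  by exists a, b; split => //; rewrite !mulr0 addr0 g0.
move=> n0.
set n := _ + _ in n0.
set G := g x0 y0.
(* Hahn-Banach by hand: [c] is the slope to assign to the direction orthogonal
   to [(x0, y0)]. *)
pose A := [set s * G - g (s * x0 + y0) (s * y0 - x0) | s in [set: R]].
(* The two test vectors add up to [s + s'] times [(x0, y0)], where [glin] bounds [g] from below. So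
   every lower constraint on the slope lies below every upper one. *)
have Aub s' : ubound A (g (s' * x0 - y0) (s' * y0 + x0) - s' * G).
  move=> _ [s _ <-].
  have := gsub (s * x0 + y0) (s * y0 - x0) (s' * x0 - y0) (s' * y0 + x0).
  have -> : s * x0 + y0 + (s' * x0 - y0) = (s + s') * x0 by ring.
  have -> : s * y0 - x0 + (s' * y0 + x0) = (s + s') * y0 by ring.
  have := glin (s + s') x0 y0; rewrite -/G; lra.
have An0 : A !=set0 by exists (0 * G - g (0 * x0 + y0) (0 * y0 - x0)), 0.
pose c := sup A.
have c1 s : s * G - g (s * x0 + y0) (s * y0 - x0) <= c.
  by apply: ub_le_sup; [exists (g (0 * x0 - y0) (0 * y0 + x0) - 0 * G); exact: Aub|exists s].
have c2 s : c <= g (s * x0 - y0) (s * y0 + x0) - s * G by exact: ge_sup.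
exists ((G * x0 - c * y0) / n), ((G * y0 + c * x0) / n); split; last first.
  by rewrite /n; field; rewrite gt_eqF.
move=> x y.
(* Coordinates of [(x, y)] in the orthogonal basis [(x0, y0)], [(- y0, x0)]. The sign of [t] selects
   [c1] or [c2], after scaling the second coordinate to minus one or one. *)
pose s := (x * x0 + y * y0) / n; pose t := (y * x0 - x * y0) / n.
have -> : (G * x0 - c * y0) / n * x + (G * y0 + c * x0) / n * y = s * G + t * c.
  by rewrite /s /t; ring.
have xE : x = s * x0 - t * y0 by rewrite /s /t /n; field; rewrite gt_eqF.
have yE : y = s * y0 + t * x0 by rewrite /s /t /n; field; rewrite gt_eqF.
clearbody s t; rewrite {}xE {}yE.
have [t0|t0|->] := ltgtP t 0.
- have := c1 (s / - t).
  have -> : s * x0 - t * y0 = - t * (s / - t * x0 + y0) by field; rewrite lt_eqF.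
  have -> : s * y0 + t * x0 = - t * (s / - t * y0 - x0) by field; rewrite lt_eqF.
  rewrite ghom ?oppr_gt0// => h.
  have t0' : 0 < - t by rewrite oppr_gt0.
  have := ler_wpM2l (ltW t0') h.
  have -> : - t * (s / - t * G - g (s / - t * x0 + y0) (s / - t * y0 - x0)) =
     s * G - - t * g (s / - t * x0 + y0) (s / - t * y0 - x0) by field; rewrite lt_eqF.
  lra.
- have := c2 (s / t).
  have -> : s * x0 - t * y0 = t * (s / t * x0 - y0) by field; rewrite gt_eqF.
  have -> : s * y0 + t * x0 = t * (s / t * y0 + x0) by field; rewrite gt_eqF.
  rewrite ghom// => h.
  have := ler_wpM2l (ltW t0) h.
  have -> : t * (g (s / t * x0 - y0) (s / t * y0 + x0) - s / t * G) =
     t * g (s / t * x0 - y0) (s / t * y0 + x0) - s * G by field; rewrite gt_eqF.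
  lra.
- by rewrite !mul0r subr0 !addr0; exact: glin.
Qed.

Lemma normr_fst_enorm (R : realType) (p : R * R) : `|p.1| <= enorm p.
Proof.
rewrite -[leLHS]sqrtr_sqr; rewrite /enorm ler_sqrt.
  by rewrite lerDl sqr_ge0.
by rewrite addr_ge0// sqr_ge0.
Qed.

Lemma normr_snd_enorm (R : realType) (p : R * R) : `|p.2| <= enorm p.
Proof.
rewrite -[leLHS]sqrtr_sqr; rewrite /enorm ler_sqrt.
  by rewrite lerDr sqr_ge0.
by rewrite addr_ge0// sqr_ge0.
Qed.

Lemma enorm_le_sum (R : realType) (p : R * R) : enorm p <= `|p.1| + `|p.2|.
Proof.
have h : 0 <= `|p.1| + `|p.2| by rewrite addr_ge0.
rewrite -[leRHS]ger0_norm// -[leRHS]sqrtr_sqr /enorm ler_sqrt ?sqr_ge0//.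
rewrite sqrrD !real_normK ?num_real//.
have := mulr_ge0 (normr_ge0 p.1) (normr_ge0 p.2); lra.
Qed.

(** * Curves of class W11 *)

Section curves.
Variable R : realType.
Local Notation mu := (@lebesgue_measure R).

(** Not the energy of the inscribed polygon itself: on each edge the base point of [F] is frozen at
    the initial vertex. *)
Definition polygon_energy (F : R * R -> R * R -> R) (w : R -> R * R) (N : nat) : R :=
  \sum_(k < N) F (w (k%:R / N%:R))
    ((w (k.+1%:R / N%:R)).1 - (w (k%:R / N%:R)).1,
     (w (k.+1%:R / N%:R)).2 - (w (k%:R / N%:R)).2).

(** Here freezing the base point is exact: on an edge from $p$ to $q$ the discarded term is a
    multiple of $(q-p)\cdot i(q-p)=0$. *)
Definition polygon_area (w : R -> R * R) (N : nat) : R :=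
  \sum_(k < N) 2^-1 *
    ((w (k%:R / N%:R)).1 * - ((w (k.+1%:R / N%:R)).2 - (w (k%:R / N%:R)).2) +
     (w (k%:R / N%:R)).2 * ((w (k.+1%:R / N%:R)).1 - (w (k%:R / N%:R)).1)).

(** One component of [W11], with the real-valued integral in place of the extended one so that
    ordinary arithmetic applies. *)
Definition primitive_of (g f : R -> R) := forall a b, a <= b ->
  mu.-integrable `[a, b] (EFin \o g) /\ f b - f a = \int[mu]_(t in `[a, b]) g t.

Lemma primitive_continuous (g f : R -> R) : primitive_of g f -> continuous f.
Proof.
move=> gf x.
have x1 : x - 1 <= x + 1 by lra.
have [gi _] := gf _ _ x1.
have ci : {within `[x - 1, x + 1], continuous
    (fun t => f (x - 1) + parameterized_integral mu (x - 1) t g)}.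
  move=> t; apply: cvgD; first exact: cvg_cst.
  exact: (parameterized_integral_continuous x1 gi).
have cf : {within `[x - 1, x + 1], continuous f}.
  move: ci; apply: subspace_eq_continuous => t; rewrite inE/= in_itv/= => /andP[t1 t2].
  rewrite [LHS]/from_subspace [RHS]/from_subspace /parameterized_integral.
  by rewrite -(gf _ _ t1).2 addrC subrK.
have x2 : x - 1 < x + 1 by lra.
have [h _ _] := (continuous_within_itvP _ x2).1 cf.
by apply: h; rewrite in_itv/=; lra.
Qed.

Lemma W11_primitive1 (u v : R -> R * R) : W11 u v ->
  primitive_of (fun t => (v t).1) (fun t => (u t).1).
Proof.
case=> _ h a b ab; have [h1 h2 h3 h4] := h a b ab; split => //.
by apply: EFin_inj; rewrite h3 Rintegral_EFin.
Qed.

Lemma W11_primitive2 (u v : R -> R * R) : W11 u v ->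
  primitive_of (fun t => (v t).2) (fun t => (u t).2).
Proof.
case=> _ h a b ab; have [h1 h2 h3 h4] := h a b ab; split => //.
by apply: EFin_inj; rewrite h4 Rintegral_EFin.
Qed.

Lemma primitive_W11 (u v : R -> R * R) : (forall t, u (t + 1) = u t) ->
  primitive_of (fun t => (v t).1) (fun t => (u t).1) ->
  primitive_of (fun t => (v t).2) (fun t => (u t).2) -> W11 u v.
Proof.
move=> per p1 p2; split => // a b ab.
have [i1 e1] := p1 a b ab; have [i2 e2] := p2 a b ab.
by split => //; rewrite Rintegral_EFin// -?e1 -?e2.
Qed.

Lemma integrable_dominated (f g : R -> R) (a b : R) :
  measurable_fun `[a, b] f -> (forall t, t \in `[a, b] -> `|f t| <= g t) ->
  mu.-integrable `[a, b] (EFin \o g) -> mu.-integrable `[a, b] (EFin \o f).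
Proof.
move=> mf fg; apply: le_integrable => //; first exact/measurable_EFinP.
move=> t tab /=; rewrite lee_fin; apply: le_trans (fg t _) (ler_norm _).
by rewrite inE in tab *.
Qed.

Lemma integrable_scale (f : R -> R) (a b c : R) :
  mu.-integrable `[a, b] (EFin \o f) ->
  mu.-integrable `[a, b] (EFin \o (fun t => c * f t)).
Proof.
move=> fi; rewrite (_ : EFin \o _ = (fun t => c%:E * (EFin \o f) t)%E)//.
exact: integrableZl.
Qed.

Lemma integrable_sub (f g : R -> R) (a b : R) :
  mu.-integrable `[a, b] (EFin \o f) -> mu.-integrable `[a, b] (EFin \o g) ->
  mu.-integrable `[a, b] (EFin \o (fun t => f t - g t)).
Proof.
move=> fi gi; rewrite (_ : EFin \o _ = (EFin \o f) \- (EFin \o g))%E//.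
exact: integrableB.
Qed.

Lemma Rintegral_scale (f : R -> R) (a b c : R) :
  mu.-integrable `[a, b] (EFin \o f) ->
  c * \int[mu]_(t in `[a, b]) f t = \int[mu]_(t in `[a, b]) (c * f t).
Proof. by move=> fi; rewrite RintegralZl. Qed.

Lemma Rintegral_partition (f : R -> R) (N : nat) (s : nat -> R) :
  (forall k, (k < N)%N -> s k <= s k.+1) -> s 0%N = 0 -> s N = 1 ->
  mu.-integrable `[0, 1] (EFin \o f) ->
  \int[mu]_(t in `[0, 1]) f t = \sum_(k < N) \int[mu]_(t in `[s k, s k.+1]) f t.
Proof. by move=> smono s0 sN fi; rewrite -Rintegral_itv_sum// s0 sN. Qed.

Section curve.
Variables u v : R -> R * R.
Hypothesis uv : W11 u v.

Let p1 := W11_primitive1 uv.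
Let p2 := W11_primitive2 uv.

Lemma W11_measurable_derivative (a b : R) : a <= b ->
  measurable_fun `[a, b] (fun t => (v t).1) /\ measurable_fun `[a, b] (fun t => (v t).2).
Proof.
move=> ab; have [i1 _] := p1 ab; have [i2 _] := p2 ab.
by split; apply/measurable_EFinP; [case/integrableP: i1|case/integrableP: i2].
Qed.

Lemma W11_measurable_curve (D : set R) : measurable D ->
  measurable_fun D (fun t => (u t).1) /\ measurable_fun D (fun t => (u t).2).
Proof.
move=> mD; split; apply: measurable_funTS; apply: continuous_measurable_fun.
- exact: primitive_continuous p1.
- exact: primitive_continuous p2.
Qed.

Lemma W11_derivative_integrable (c a b : R) : a <= b ->
  mu.-integrable `[a, b] (EFin \o (fun t => c * (`|(v t).1| + `|(v t).2|))).
Proof.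
move=> ab; have [i1 _] := p1 ab; have [i2 _] := p2 ab.
rewrite (_ : EFin \o _ = (fun t => c%:E * (`|(v t).1%:E| + `|(v t).2%:E|))%E); last first.
  by apply/funext => t /=; rewrite -EFinD -EFinM.
by apply: integrableZl => //; apply: integrableD => //; exact: integrable_abse.
Qed.

Definition area_integrand t := 2^-1 * ((u t).1 * - (v t).2 + (u t).2 * (v t).1).

Lemma area_integrable a b : a <= b -> mu.-integrable `[a, b] (EFin \o area_integrand).
Proof.
move=> ab.
have [mu1 mu2] := W11_measurable_curve (measurable_itv `[a, b]).
have [mv1 mv2] := W11_measurable_derivative ab.
have cw1 : {within `[a, b], continuous (fun t => `|(u t).1|)}.
  apply: continuous_subspaceT => t; apply: cvg_norm; exact: primitive_continuous p1 _.
have cw2 : {within `[a, b], continuous (fun t => `|(u t).2|)}.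
  apply: continuous_subspaceT => t; apply: cvg_norm; exact: primitive_continuous p2 _.
have [c1 _ h1] := EVT_max ab cw1.
have [c2 _ h2] := EVT_max ab cw2.
pose c := `|(u c1).1| + `|(u c2).2|.
apply: (@integrable_dominated _ (fun t => c * (`|(v t).1| + `|(v t).2|))).
- apply: measurable_funM => //; apply: measurable_funD; apply: measurable_funM => //.
  exact: measurableT_comp.
- move=> t tab; rewrite /area_integrand normrM (@ger0_norm _ 2^-1) ?invr_ge0//.
  have := ler_normD ((u t).1 * - (v t).2) ((u t).2 * (v t).1).
  rewrite !normrM normrN => le1.
  have := ler_wpM2r (normr_ge0 (v t).2) (h1 _ tab).
  have := ler_wpM2r (normr_ge0 (v t).1) (h2 _ tab).
  have := mulr_ge0 (normr_ge0 (u c1).1) (normr_ge0 (v t).1).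
  have := mulr_ge0 (normr_ge0 (u c1).1) (normr_ge0 (v t).2).
  have := mulr_ge0 (normr_ge0 (u c2).2) (normr_ge0 (v t).1).
  have := mulr_ge0 (normr_ge0 (u c2).2) (normr_ge0 (v t).2).
  rewrite /c; nra.
- exact: W11_derivative_integrable.
Qed.

Lemma Acal_Rintegral : Acal u v = (\int[mu]_(t in `[0, 1]) area_integrand t)%:E.
Proof. by rewrite -Rintegral_EFin//; exact: area_integrable. Qed.

End curve.

(** Area is translation invariant because the curve is closed: the extra terms are multiples of the
    integral of [v] over a period, which is [u 1 - u 0 = 0]. This permits normalizing the starting
    point of each competitor. *)
Lemma W11_translate (u v : R -> R * R) (c1 c2 : R) : W11 u v ->
  let u' t := ((u t).1 + c1, (u t).2 + c2) in W11 u' v /\ Acal u' v = Acal u v.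
Proof.
move=> uv u'.
have p1 := W11_primitive1 uv; have p2 := W11_primitive2 uv.
have uv' : W11 u' v.
  apply: primitive_W11 => [t|a b ab|a b ab].
  - by rewrite /u' (proj1 uv).
  - have [i1 e1] := p1 _ _ ab; split => //; rewrite -e1 /u' /=; ring.
  - have [i1 e1] := p2 _ _ ab; split => //; rewrite -e1 /u' /=; ring.
split => //; rewrite !Acal_Rintegral//; congr EFin.
have [i1 e1] := p1 _ _ (@ler01 R); have [i2 e2] := p2 _ _ (@ler01 R).
have per : u 1 = u 0 by rewrite -[in LHS](add0r 1) (proj1 uv).
have j1 : mu.-integrable `[0, 1] (EFin \o (fun t => (- 2^-1 * c1) * (v t).2)).
  exact: integrable_scale.
have j2 : mu.-integrable `[0, 1] (EFin \o (fun t => (2^-1 * c2) * (v t).1)).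
  exact: integrable_scale.
have iA := area_integrable uv (@ler01 R).
have j3 : mu.-integrable `[0, 1] (EFin \o
    (fun t => area_integrand u v t + (- 2^-1 * c1) * (v t).2)).
  exact: (integrableD _ iA j1).
transitivity (\int[mu]_(t in `[0, 1])
   (area_integrand u v t + (- 2^-1 * c1) * (v t).2 + (2^-1 * c2) * (v t).1)).
  by apply: eq_Rintegral => t _; rewrite /area_integrand /u' /=; ring.
rewrite RintegralD// RintegralD// -(Rintegral_scale _ i1) -(Rintegral_scale _ i2).
by rewrite -e1 -e2 per !subrr !mulr0 !addr0.
Qed.

End curves.

(** * Weak derivatives of Lipschitz functions *)

Section lipschitz_primitive.
Variable R : realType.
Local Notation mu := (@lebesgue_measure R).

Lemma ae_impl (P Q : R -> Prop) : (forall t, P t -> Q t) ->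
  {ae mu, forall t, P t} -> {ae mu, forall t, Q t}.
Proof. by move=> PQ; apply: filterS => //; exact: (ae_filter_ringOfSetsType mu). Qed.

Lemma ae_and (P Q : R -> Prop) : {ae mu, forall t, P t} -> {ae mu, forall t, Q t} ->
  {ae mu, forall t, P t /\ Q t}.
Proof.
have FF := ae_filter_ringOfSetsType mu; exact: filterI.
Qed.

Lemma lipschitz_continuous (f : R -> R) (L : R) :
  (forall s t, `|f s - f t| <= L * `|s - t|) -> continuous f.
Proof.
move=> lip x.
have L0 : 0 <= L by have := lip 0 1; rewrite sub0r normrN1 mulr1; exact: le_trans.
apply/cvgrPdist_le => e e0.
exists (e / (L + 1)) => /=; first by rewrite divr_gt0//; lra.
move=> t /=; rewrite ltr_pdivlMr; last lra.
move=> h; apply: le_trans (lip x t) _; have := normr_ge0 (x - t); nra.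
Qed.

Lemma stieltjes_measure_itv (h : cumulative R R) (a b : R) : a <= b ->
  lebesgue_stieltjes_measure h `]a, b]%classic = (h b - h a)%:E.
Proof.
move=> ab; rewrite /lebesgue_stieltjes_measure /measure_extension.
by rewrite measurable_mu_extE/= ?wlength_itv_bnd//; exists (a, b).
Qed.

(** Both measures are computed from covers by half-open intervals, and each interval has [h]-length
    at most [K] times its Lebesgue length. A cover of small total length is therefore small for [h]
    as well. *)
Lemma stieltjes_dominated (h : cumulative R R) (K : R) : 0 <= K ->
  (forall x y, x <= y -> h y - h x <= K * (y - x)) ->
  forall A, measurable A -> mu A = 0%E -> lebesgue_stieltjes_measure h A = 0%E.
Proof.
move=> K0 hK A mA A0.
(* [K + 1] stands in for [K] so that dividing by it is legitimate when [K = 0]. *)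
have K1 : 0 < K + 1 by lra.
apply/eqP; rewrite eq_le measure_ge0 andbT; apply/lee_addgt0Pr => e e0; rewrite add0e.
have : (mu A < (e / (K + 1))%:E)%E by rewrite A0 lte_fin divr_gt0.
rewrite /lebesgue_measure /lebesgue_stieltjes_measure /measure_extension.
move=> /ereal_inf_lt[_ [G [mG AG] <-] lt].
apply: (@le_trans _ _ (\sum_(0 <= k <oo) wlength h (G k))%E).
  by apply: ereal_inf_lbound; exists G.
apply: (@le_trans _ _ (\sum_(0 <= k <oo) (K + 1)%:E * wlength idfun (G k))%E).
  apply: lee_nneseries => [k _ _|k _]; first exact: wlength_ge0.
  have [[a b] _ <-] := mG k => /=.
  have [ab|ba] := leP a b; last first.
    have -> : `]a, b]%classic = set0 :> set R.
      by rewrite set_itv_ge// bnd_simp -leNgt ltW.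
    by rewrite !wlength0 mule0.
  rewrite !wlength_itv_bnd// -EFinM lee_fin; apply: le_trans (hK _ _ ab) _.
  by rewrite /= ler_wpM2r//; lra.
rewrite nneseriesZl; last by move=> k _; exact: wlength_ge0.
rewrite -lee_pdivlMl//; apply: ltW; apply: lt_le_trans lt _.
by rewrite -EFinM mulrC.
Qed.

(* The Lebesgue-Stieltjes measure of the nondecreasing function
   [x |-> f x + L * x], restricted to [`]- n, n]], is dominated by Lebesgue
   measure. *)
Lemma lipschitz_local_primitive (f : R -> R) (L : R) (n : nat) :
  (forall s t, `|f s - f t| <= L * `|s - t|) ->
  exists G : R -> R, mu.-integrable setT (EFin \o G) /\
    forall a b, - n%:R <= a -> a <= b -> b <= n%:R ->
      f b - f a + L * (b - a) = \int[mu]_(t in `[a, b]) G t.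
Proof.
move=> lip.
have L0 : 0 <= L by have := lip 0 1; rewrite sub0r normrN1 mulr1; exact: le_trans.
have fc := lipschitz_continuous lip.
pose h x := f x + L * x.
(* The slopes of [h] lie between [0] and [2 * L]: the lower bound gives a positive measure, the
   upper one its domination by Lebesgue measure. *)
have hB x y : x <= y -> 0 <= h y - h x /\ h y - h x <= (2 * L) * (y - x).
  move=> xy; have := lip y x; rewrite (@ger0_norm _ (y - x)) ?subr_ge0//.
  rewrite ler_norml /h => /andP[? ?]; split; lra.
have hnd : nondecreasing h by move=> x y xy; rewrite -subr_ge0; exact: (hB _ _ xy).1.
have hrc : right_continuous h.
  apply: right_continuousW => x; apply: cvgD; first exact: fc.
  by apply: cvgMr; exact: cvg_id.
pose hc : cumulative R R := HB.pack h (isCumulative.Build R _ R h hnd hrc).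
pose I := `]- n%:R, n%:R]%classic : set R.
have mI : measurable I by exact: measurable_itv.
have n0 : - n%:R <= n%:R :> R by have := ler0n R n; lra.
have hI : (lebesgue_stieltjes_measure hc I < +oo)%E.
  by rewrite stieltjes_measure_itv// ltry.
pose nu0 : {measure set (g_sigma_algebraType R.-ocitv.-measurable) -> \bar R} :=
  lebesgue_stieltjes_measure hc.
pose nu : {finite_measure set (g_sigma_algebraType R.-ocitv.-measurable) -> \bar R} :=
  @mfrestr _ (g_sigma_algebraType R.-ocitv.-measurable) R I nu0 mI hI.
have dom : nu `<< mu.
  apply/null_content_dominatesP => A mA A0.
  apply/eqP; rewrite eq_le measure_ge0 andbT.
  have <- := stieltjes_dominated (h := hc) (mulr_ge0 (ler0n R 2) L0)
     (fun x y xy => (hB x y xy).2) mA A0.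
  by apply: le_measure; rewrite ?inE//; exact: measurableI.
have [g [g0 gfin gi gE]] := radon_nikodym_sigma_finite dom.
have gEF : EFin \o (fine \o g) = g by apply/funext => t /=; rewrite fineK.
exists (fine \o g); split; first by rewrite gEF.
move=> a b na ab bn.
have abI : `]a, b]%classic `&` I = `]a, b]%classic.
  by apply: setIidl; apply: subset_itv; rewrite bnd_simp.
have := gE _ (measurable_itv `]a, b]).
rewrite /nu /= /mfrestr /mrestr abI stieltjes_measure_itv//= => e.
rewrite -Rintegral_itv_obnd_cbnd ?gEF; last exact: integrableS gi.
transitivity (fine (\int[mu]_(x in `]a, b]) g x)%E); first by rewrite -e /= /h; ring.
by rewrite /Rintegral; congr fine; apply: eq_integral => x _ /=; rewrite fineK.
Qed.

(** Differentiability at [t] with derivative [d], as a first-order expansion free of division: it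
    can be applied at both ends of an interval around [t], even when one end is [t] itself. *)
Definition has_slope (f : R -> R) (t d : R) := forall e, 0 < e ->
  exists2 r, 0 < r & forall s, `|s - t| < r -> `|f s - f t - d * (s - t)| <= e * `|s - t|.

Lemma derivable_has_slope (f : R -> R) (t : R) :
  derivable f t 1 -> has_slope f t (derive1 f t).
Proof.
move=> df e e0.
have dl : h^-1 *: (f (h + t) - f t) @[h --> 0^'] --> derive1 f t.
  rewrite derive1E; move: df; rewrite /derivable /derive.
  under eq_fun do rewrite scaler1.
  by [].
move/cvgrPdist_le : dl => /(_ _ e0) /nbhs_ballP[r /= r0 H].
exists r => // s st.
have [->|nst] := eqVneq s t; first by rewrite !subrr mulr0 subr0 normr0 mulr0.
have st0 : s - t != 0 by rewrite subr_eq0.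
have bst : ball 0 r (s - t) by rewrite /ball/= sub0r normrN.
have := H _ bst st0.
rewrite subrK => h.
rewrite (_ : f s - f t - _ = - ((derive1 f t - (s - t)^-1 *: (f s - f t)) * (s - t))).
  by rewrite normrN normrM ler_wpM2r.
by rewrite /GRing.scale/=; field.
Qed.

Lemma has_slope_cvg (f : R -> R) (t d : R) : has_slope f t d ->
  n.+1%:R * (f (t + n.+1%:R^-1) - f t) @[n --> \oo] --> d.
Proof.
move=> sl; apply/cvgrPdist_le => e e0; have [r r0 H] := sl e e0.
near=> n.
have n0 : 0 < n.+1%:R^-1 :> R by rewrite invr_gt0.
have nr : n.+1%:R^-1 < r by near: n; exact: (near_infty_natSinv_lt (PosNum r0)).
have := H (t + n.+1%:R^-1); rewrite addrAC subrr add0r gtr0_norm// => /(_ nr).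
rewrite ler_pdivlMr ?ltr0n// -[X in _ * X](@ger0_norm _ n.+1%:R)// -normrM distrC.
by congr (`| _ | <= _); rewrite mulrBl divfK// mulrC.
Unshelve. all: by end_near. Qed.

Lemma lipschitz_primitive (f : R -> R) (L : R) :
  (forall s t, `|f s - f t| <= L * `|s - t|) ->
  exists v : R -> R, (forall a b, a <= b ->
    mu.-integrable `[a, b] (EFin \o v) /\ f b - f a = \int[mu]_(t in `[a, b]) v t) /\
   {ae mu, forall t, has_slope f t (v t)}.
Proof.
move=> lip.
have fc := lipschitz_continuous lip.
(* Radon-Nikodym only gives a derivative on each bounded interval, up to null
   sets; the upper limit of the difference quotients is a Borel function on the
   whole line that agrees with all of them. *)
pose D (k : nat) t := k.+1%:R * (f (t + k.+1%:R^-1) - f t).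
pose v t := limn_sup (D^~ t).
have vlim t d : has_slope f t d -> v t = d.
  by move=> /has_slope_cvg h; rewrite /v (cvg_limn_inf_sup h).2.
have Db k t : `|D k t| <= L.
  rewrite /D normrM ger0_norm// -ler_pdivlMl//.
  apply: le_trans (lip _ _) _.
  by rewrite addrAC subrr add0r ger0_norm ?invr_ge0// mulrC.
have vm : measurable_fun setT v.
  apply: measurable_fun_limn_sup => [t _|t _|k].
  - by exists L => _ [k _ <-]; have := Db k t; rewrite ler_norml => /andP[].
  - by exists (- L) => _ [k _ <-]; have := Db k t; rewrite ler_norml => /andP[].
  - apply: continuous_measurable_fun => t; apply: cvgMr; apply: cvgB; last exact: fc.
    apply: (@cvg_comp _ _ _ (fun t => t + k.+1%:R^-1) f _ (nbhs (t + k.+1%:R^-1))); last exact: fc.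
    by apply: cvgD; [exact: cvg_id|exact: cvg_cst].
(* [G] is a density for [f x + L * x], whence the slope [G t - L]; Lebesgue differentiation supplies
   it at almost every point of the open interval. *)
have loc (n : nat) : exists G : R -> R, [/\ mu.-integrable setT (EFin \o G),
    (forall a b, - n%:R <= a -> a <= b -> b <= n%:R ->
      f b - f a + L * (b - a) = \int[mu]_(t in `[a, b]) G t) &
    {ae mu, forall t, - n%:R < t < n%:R -> has_slope f t (G t - L)}].
  have [G [Gi GE]] := lipschitz_local_primitive n lip.
  exists G; split => //.
  have Gi' y : mu.-integrable `]-oo, y] (EFin \o G) by exact: integrableS Gi.
  have Gl : locally_integrable [set: R] G.
    by have := integrable_locally measurableT Gi; rewrite patch_setT.
  apply: ae_impl (FTC1Ny Gi' Gl) => t [dG dE] /andP[t1 t2] e e0.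
  have [r r0 H] := derivable_has_slope dG e0.
  (* The two extra minima keep [s] between [- n] and [n], where [G] represents [f]. *)
  exists (Num.min r (Num.min (t + n%:R) (n%:R - t))).
    by rewrite !lt_min r0/=; apply/andP; split; lra.
  move=> s; rewrite !lt_min => /and3P[s1 s2 s3].
  have := H _ s1; rewrite dE.
  have sn : - n%:R <= s <= n%:R.
    move: s2 s3; rewrite !ltr_norml => /andP[? ?] /andP[? ?]; apply/andP; split; lra.
  set Q := \int[mu]_(t in `]-oo, s]) G t - _.
  suff -> : Q = f s - f t + L * (s - t).
    by congr (`| _ | <= _); ring.
  have key a b : - n%:R <= a -> a <= b -> b <= n%:R ->
      \int[mu]_(t in `]-oo, b]) G t - \int[mu]_(t in `]-oo, a]) G t =
      f b - f a + L * (b - a).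
    move=> na ab bn; rewrite GE// Rintegral_itvB//.
    by rewrite Rintegral_itv_obnd_cbnd//; exact: integrableS Gi.
  case/andP: sn => sn1 sn2; rewrite /Q.
  have [ts|st] := leP t s; first by rewrite key//; lra.
  by have := key s t sn1 (ltW st); lra.
exists v; split; last first.
  have : {ae mu, forall t, forall n : nat, - n%:R < t < n%:R -> has_slope f t (v t)}.
    apply: ae_foralln => n; have [G [_ _]] := loc n.
    by apply: ae_impl => t H /H h; rewrite (vlim _ _ h).
  apply: ae_impl => t /(_ (Num.bound `|t|)); apply.
  by rewrite -ltr_norml; exact: archi_boundP (normr_ge0 t).
move=> a b ab.
pose n := maxn (Num.bound `|a|) (Num.bound `|b|).
have [G [Gi GE Gs]] := loc n.
have an : - n%:R < a.
  have /ltr_normlP[h _] : `|a| < n%:R.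
    by apply: lt_le_trans (archi_boundP (normr_ge0 a)) _; rewrite ler_nat leq_maxl.
  lra.
have bn : b < n%:R.
  have /ltr_normlP[_ h] : `|b| < n%:R.
    by apply: lt_le_trans (archi_boundP (normr_ge0 b)) _; rewrite ler_nat leq_maxr.
  lra.
have mv : measurable_fun `[a, b] v by exact: measurable_funTS.
have ci := integrable_itv_cst a b L.
have Gi' : mu.-integrable `[a, b] (EFin \o G) by exact: integrableS Gi.
have GLi := integrable_sub Gi' ci.
have vG : ae_eq mu (`[a, b]%classic : set R) (EFin \o v) (EFin \o (fun t => G t - L)).
  apply: ae_impl Gs => t H /=; rewrite in_itv/= => /andP[ta tb].
  congr EFin; apply: vlim; apply: H; apply/andP; split.
  - exact: lt_le_trans ta.
  - exact: le_lt_trans bn.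
have mev : measurable_fun `[a, b] (EFin \o v) by exact/measurable_EFinP.
have vi : mu.-integrable `[a, b] (EFin \o v).
  apply/integrableP; split => //.
  case/integrableP : GLi => mG; apply: le_lt_trans.
  rewrite le_eqVlt; apply/orP; left; apply/eqP; apply: ge0_ae_eq_integral => //.
  - exact: measurableT_comp.
  - exact: measurableT_comp.
  - exact: ae_eq_abse.
split => //.
have -> : \int[mu]_(t in `[a, b]) v t = \int[mu]_(t in `[a, b]) (G t - L).
  rewrite /Rintegral; congr fine; apply: ae_eq_integral => //.
  by case/integrableP : GLi.
rewrite RintegralB// Rintegral_itv_cst// -(GE _ _ (ltW an) ab (ltW bn)).
by ring.
Qed.

End lipschitz_primitive.

(** * Uniform grids and difference quotients *)

Section grid.
Variable R : realType.

Lemma grid_approx_itv (n : nat) (t : R) :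
  grid_approx n t <= t < grid_approx n t + n.+1%:R^-1.
Proof.
have n0 : 0 < n.+1%:R :> R by rewrite ltr0n.
have /andP[h1 h2] := floor_itv (n.+1%:R * t).
rewrite /grid_approx ler_pdivrMr// [t * _]mulrC h1 /=.
rewrite -[X in _ + X]mul1r -mulrDl ltr_pdivlMr// mulrC.
by apply: lt_le_trans h2 _; rewrite intrD.
Qed.

Lemma grid_approxE (n k : nat) (t : R) :
  k%:R / n.+1%:R <= t < k.+1%:R / n.+1%:R -> grid_approx n t = k%:R / n.+1%:R.
Proof.
have n0 : 0 < n.+1%:R :> R by rewrite ltr0n.
rewrite ler_pdivrMr// ltr_pdivlMr// mulrC => h.
have e : (k%:Z + 1)%:~R = k.+1%:R :> R by rewrite -natr1 intrD.
by rewrite /grid_approx (@floor_def _ _ k%:Z)// e.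
Qed.

Lemma grid_approx_mono (n : nat) : {homo @grid_approx R n : x y / x <= y}.
Proof.
move=> x y xy; rewrite /grid_approx ler_pM2r ?invr_gt0// ler_int.
by apply: le_floor; rewrite ler_pM2l.
Qed.

(** The mesh interval contains [t] but need not start there, so this is a straddle estimate: the
    first-order errors at the two ends are at most [e] times their distances to [t], and these
    distances add up to the mesh. *)
Lemma has_slope_grid (f : R -> R) (t d : R) : has_slope f t d ->
  n.+1%:R * (f (grid_approx n t + n.+1%:R^-1) - f (grid_approx n t)) @[n --> \oo] --> d.
Proof.
move=> sl; apply/cvgrPdist_le => e e0; have [r r0 H] := sl e e0.
near=> n.
have n0 : 0 < n.+1%:R^-1 :> R by rewrite invr_gt0.
have nr : n.+1%:R^-1 < r by near: n; exact: (near_infty_natSinv_lt (PosNum r0)).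
have /andP[g1 g2] := grid_approx_itv n t.
set g := grid_approx n t in g1 g2 *.
have aE : `|g - t| = t - g by rewrite distrC ger0_norm// subr_ge0.
have bE : `|g + n.+1%:R^-1 - t| = g + n.+1%:R^-1 - t by rewrite ger0_norm// subr_ge0 ltW.
have ha : `|g - t| < r by rewrite aE; apply: lt_trans nr; rewrite ltrBlDl.
have hb : `|g + n.+1%:R^-1 - t| < r.
  by rewrite bE; apply: le_lt_trans nr; rewrite lerBlDr addrC lerD2l.
have := H _ ha; have := H _ hb; rewrite aE bE => h1 h2.
have n1 : n.+1%:R * n.+1%:R^-1 = 1 :> R by rewrite divff.
have -> : d - n.+1%:R * (f (g + n.+1%:R^-1) - f g) =
  n.+1%:R * ((f g - f t - d * (g - t)) -
     (f (g + n.+1%:R^-1) - f t - d * (g + n.+1%:R^-1 - t))).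
  transitivity (d * (n.+1%:R / n.+1%:R) - n.+1%:R * (f (g + n.+1%:R^-1) - f g)).
    by rewrite n1 mulr1.
  by ring.
rewrite normrM ger0_norm// mulrC -ler_pdivlMr//.
apply: le_trans (ler_normB _ _) _; apply: le_trans (lerD h2 h1) _.
by rewrite -mulrDr; apply: ler_wpM2l (ltW e0) _ _ _; rewrite addrC addrA subrK addrAC subrr add0r.
Unshelve. all: by end_near. Qed.

Lemma limn_einf_le (u : (\bar R)^nat) (B : \bar R) :
  (\forall n \near \oo, (u n <= B)%E) -> (limn_einf u <= B)%E.
Proof.
move=> h; rewrite limn_einf_lim; apply: lime_le; first exact: is_cvg_einfs.
apply: filterS h => n; apply: le_trans; apply: ereal_inf_lbound.
by exists n => /=.
Qed.

End grid.

(** * A closed curve of prescribed area *)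

Section circle.
Variable R : realType.
Local Notation mu := (@lebesgue_measure R).

Lemma is_derive_primitive (f g : R -> R) :
  (forall x, is_derive x (1 : R) f (g x)) -> continuous g -> primitive_of g f.
Proof.
move=> fg cg a b ab.
have gi : mu.-integrable `[a, b] (EFin \o g).
  apply: continuous_compact_integrable; first exact: segment_compact.
  exact: continuous_subspaceT.
split => //; apply: EFin_inj; rewrite -Rintegral_EFin//.
move: ab; rewrite le_eqVlt => /predU1P[->|ab].
  by rewrite subrr set_itv1 integral_set1.
have cf : continuous f.
  move=> x; apply: differentiable_continuous; apply/derivable1_diffP.
  by have [] := fg x.
rewrite (@continuous_FTC2 _ g f a b)//.
- exact: continuous_subspaceT.
- split => [x _||].
  + by have [] := fg x.
  + exact/cvg_at_right_filter/cf.
  + exact/cvg_at_left_filter/cf.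
- by move=> x _; rewrite derive1E; exact: (@derive_val _ _ _ _ _ _ _ (fg x)).
Qed.

Lemma area_nonempty (tau : R) : exists u v : R -> R * R, W11 u v /\ Acal u v = tau%:E.
Proof.
pose p2 : R := 2 * pi.
(* With the sign convention of [Acal], the ellipse with half-axes [1] and [c]
   has area [- pi * c]. *)
pose c : R := - tau / pi.
have pi0 : pi != 0 :> R by rewrite gt_eqF// pi_gt0.
pose u t : R * R := (cos (p2 * t), c * sin (p2 * t)).
pose v t : R * R := (- p2 * sin (p2 * t), c * p2 * cos (p2 * t)).
have cl (x : R) : {for x, continuous (fun t => p2 * t)}.
  by apply: cvgMr; exact: cvg_id.
have dl (x : R) : is_derive x (1 : R) (fun t => p2 * t) p2.
  have : is_derive x (1 : R) (p2 \*: (@id R)) (p2 *: 1) by exact: is_deriveZ.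
  by rewrite /GRing.scale/= mulr1.
have csin : continuous (fun t : R => sin (p2 * t)).
  by move=> x; apply: (cvg_comp _ _ (cl x)); exact: continuous_sin.
have ccos : continuous (fun t : R => cos (p2 * t)).
  by move=> x; apply: (cvg_comp _ _ (cl x)); exact: continuous_cos.
have uv : W11 u v.
  apply: primitive_W11 => /=.
  - move=> t; rewrite /u mulrDr mulr1 [X in _ + X](_ : p2 = pi *+ 2); last by rewrite /p2 mulr_natl.
    by rewrite cosD2pi sinD2pi.
  - apply: is_derive_primitive => [x|].
      have := is_derive1_comp (is_derive_cos (p2 * x)) (dl x).
      by rewrite (_ : - sin (p2 * x) * p2 = - p2 * sin (p2 * x))//; ring.
    by move=> x; apply: cvgMr; exact: csin.
  - apply: is_derive_primitive => [x|].
      have := is_derive1_comp (is_derive_sin (p2 * x)) (dl x).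
      move=> h; have : is_derive x (1 : R) (c \*: (sin \o (fun t => p2 * t))) (c *: (cos (p2 * x) * p2)) by exact: is_deriveZ.
      by rewrite /GRing.scale/= (_ : c * (cos (p2 * x) * p2) = c * p2 * cos (p2 * x))//; ring.
    by move=> x; apply: cvgMr; exact: ccos.
exists u, v; split => //.
rewrite Acal_Rintegral//; congr EFin.
have -> : tau = tau * (1 - 0) by rewrite subr0 mulr1.
rewrite -Rintegral_itv_cst//; apply: eq_Rintegral => t _.
rewrite /area_integrand /u /v /=.
have := cos2Dsin2 (p2 * t).
set C := cos _; set S := sin _ => CS.
have -> : 2^-1 * (C * - (c * p2 * C) + c * S * (- p2 * S)) =
  - (2^-1 * c * p2) * (C ^+ 2 + S ^+ 2) by ring.
rewrite CS mulr1 /c /p2.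
have -> : - (2^-1 * (- tau / pi) * (2 * pi)) = tau * (2^-1 * 2) * (pi^-1 * pi) by ring.
by rewrite !mulVf// ?mulr1// pnatr_eq0.
Qed.

End circle.

(** * Limits along an ultrafilter *)

Lemma ultra_cvg_bounded (R : realType) (U : set_system nat) (a : nat -> R) (M : R) :
  UltraFilter U -> (forall n, `|a n| <= M) -> exists l : R, a @ U --> l.
Proof.
move=> UU aM.
have PU : ProperFilter (a @ U) by exact: fmap_proper_filter.
have /(_ (a @ U) PU) := @segment_compact R (- M) M.
case=> [|l [_ cl]]; first by apply: (@filterE _ U) => n /=; rewrite in_itv/= -ler_norml.
exists l => V nV; rewrite /= /fmap/=.
(* Compactness only yields a cluster point [l]. If the preimage of [V] were not in the ultrafilter,
   its complement would be, and [l] could not be a cluster point. *)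
have [//|UC] := in_ultra_setVsetC (a @^-1` V) UU.
by have [x [nVx Vx]] := cl (~` V) V UC nV.
Qed.

Lemma cvg_ler (R : realType) (U : set_system nat) (a : nat -> R) (l c : R) :
  ProperFilter U -> a @ U --> l -> (forall n, a n <= c) -> l <= c.
Proof.
move=> PU al ac; apply: (closed_cvg (fun x => x <= c) _ _ _ al).
  exact: closed_le.
exact: nearW.
Qed.

(** * Periodic extension from the unit interval *)

Section periodic_extension.
Variable R : realType.

Definition frac (t : R) : R := t - (Num.floor t)%:~R.

Lemma frac_itv t : 0 <= frac t < 1.
Proof.
have /andP[h1 h2] := floor_itv t; rewrite /frac subr_ge0 h1/= ltrBlDr.
by rewrite addrC; apply: lt_le_trans h2 _; rewrite intrD.
Qed.

Lemma fracD1 t : frac (t + 1) = frac t.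
Proof. by rewrite /frac floorDrz ?rpred1// floor1 intrD; ring. Qed.

Lemma frac_id t : 0 <= t < 1 -> frac t = t.
Proof.
by move=> t01; rewrite /frac (@floor_def _ t 0) ?subr0// add0r.
Qed.

Lemma frac1 : frac 1 = 0.
Proof. by rewrite /frac floor1 subrr. Qed.

(** When an integer separates [s] from [t], the two values are compared through [f 1 = f 0]: from
    [frac s] up to [1], then from [0] up to [frac t]. These two lengths sum to at most [t - s],
    since the floors differ by at least one. *)
Lemma periodic_lipschitz (f : R -> R) (C : R) : 0 <= C -> f 0 = f 1 ->
  (forall x y, 0 <= x -> x <= y -> y <= 1 -> `|f y - f x| <= C * (y - x)) ->
  forall s t, `|f (frac s) - f (frac t)| <= C * `|s - t|.
Proof.
move=> C0 f01 lip.
suff key s t : s <= t -> `|f (frac t) - f (frac s)| <= C * (t - s).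
  move=> s t; have [st|ts] := leP s t.
    by rewrite distrC [`|s - t|]distrC (@ger0_norm _ (t - s)) ?subr_ge0//; exact: key.
  by rewrite (@ger0_norm _ (s - t)) ?subr_ge0 ?(ltW ts)//; apply: key; exact: ltW.
move=> st.
have /andP[s0 s1] := frac_itv s; have /andP[t0 t1] := frac_itv t.
have := le_floor st; rewrite le_eqVlt => /predU1P[e|].
  have fe : frac t - frac s = t - s by rewrite /frac e; ring.
  by rewrite -fe; apply: lip => //; [rewrite -subr_ge0 fe subr_ge0|exact: ltW].
rewrite -lezD1 -(ler_int R) intrD => fl.
have h1 := lip 0 (frac t) (lexx 0) t0 (ltW t1).
have h2 := lip (frac s) 1 s0 (ltW s1) (lexx 1).
rewrite (_ : f (frac t) - f (frac s) = (f (frac t) - f 0) + (f 1 - f (frac s))); last first.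
  by rewrite f01; ring.
apply: le_trans (ler_normD _ _) _; apply: le_trans (lerD h1 h2) _.
rewrite -mulrDr; apply: ler_wpM2l => //.
rewrite /frac; lra.
Qed.

End periodic_extension.

(** * Existence of minimizers *)

Section minimizers.
Variable R : realType.
Local Notation mu := (@lebesgue_measure R).
Variable F : R * R -> R * R -> R.
Hypothesis Fcont : continuous (fun pq : (R * R) * (R * R) => F pq.1 pq.2).
Hypothesis Fconv : forall (p q1 q2 : R * R) (th : R), 0 <= th <= 1 ->
  F p (th * q1.1 + (1 - th) * q2.1, th * q1.2 + (1 - th) * q2.2)
    <= th * F p q1 + (1 - th) * F p q2.
Hypothesis Fhom : forall (p q : R * R) (l : R),
  0 < l -> F p (l * q.1, l * q.2) = l * F p q.
Variables m1 m2 : R.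
Hypotheses (m1_gt0 : 0 < m1) (m2_gt0 : 0 < m2).
Hypothesis Fbnd : forall p q : R * R, m1 * enorm q <= F p q /\ F p q <= m2 * enorm q.

Lemma integrand_ge0 p q : 0 <= F p q.
Proof.
by apply: le_trans (Fbnd p q).1; rewrite mulr_ge0 ?sqrtr_ge0// ltW.
Qed.

(** Midpoint convexity at the doubled vectors, combined with homogeneity, is subadditivity. So [F p]
    is sublinear and its support at [q0] is linear, with no constant term. *)
Lemma integrand_subgradient p (q0 : R * R) : exists a b : R,
  (forall q, a * q.1 + b * q.2 <= F p q) /\ a * q0.1 + b * q0.2 = F p q0.
Proof.
have [x y l l0|x y x' y'|a [b [h1 h2]]] :=
    @sublinear_subgradient R (fun x y => F p (x, y)) _ _ q0.1 q0.2.
- exact: (Fhom p (x, y)).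
- have := Fconv p (2 * x, 2 * y) (2 * x', 2 * y') (th := 2^-1).
  rewrite /= (_ : 1 - 2^-1 = 2^-1); last by field.
  rewrite !mulrA mulVf ?pnatr_eq0// !mul1r (Fhom p (x, y)) ?(Fhom p (x', y'))//.
  by rewrite !mulrA mulVf ?pnatr_eq0// !mul1r; apply; lra.
- by exists a, b; split => [q|]; [have := h1 q.1 q.2; case: q|rewrite h2; case: q0 {h2}].
Qed.

Lemma integrand_modulus (M e : R) : 0 < e -> exists2 d : R, 0 < d &
  forall p p', `|p.1| <= M -> `|p.2| <= M ->
    `|p.1 - p'.1| <= d -> `|p.2 - p'.2| <= d ->
    forall q, F p q <= (1 + e) * F p' q.
Proof.
move=> e0.
pose H (pq : (R * R) * (R * R)) := F pq.1 pq.2.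
pose K := (`[- M, M] `*` `[- M, M]) `*` (`[- 1, 1] `*` `[- 1, 1]) : set ((R * R) * (R * R)).
have cK : compact K by do 2 apply: compact_setX; exact: segment_compact.
(* The points [q] with [`|q.1| + `|q.2| = 1] satisfy [enorm q >= 1 / 2], so that
   [F p' q >= m1 / 2] absorbs the additive error. *)
pose eta := e * m1 / 2.
have eta0 : 0 < eta by rewrite divr_gt0// mulr_gt0.
(* Only the first base point is confined to the box; [p'] may leave it. The compactness argument
   therefore covers [K] by neighbourhoods taken in the whole space. *)
pose P (d : R) (x : (R * R) * (R * R)) := forall p' : R * R,
  `|x.1.1 - p'.1| <= d -> `|x.1.2 - p'.2| <= d -> `|F x.1 x.2 - F p' x.2| <= eta.
have [d d0 dP] : exists2 d, 0 < d & K `<=` P d.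
  move/compact_near_coveringP : cK => /(_ R (0^'+) P _).
  have [|h] := pselect (forall x, K x -> \forall x' \near x & i \near 0^'+, P i x'); last first.
    exfalso; apply: h => x Kx.
    have cx : H z @[z --> x] --> H x by exact: Fcont.
    move/cvgrPdist_lt : cx => /(_ (eta / 2)); rewrite divr_gt0// => /(_ isT).
    move=> /nbhs_ballP[r /= r0 hr].
    exists (ball x (r / 2), [set d | 0 < d < r / 2]).
      split; first by apply: nbhsx_ballx; rewrite divr_gt0.
      near=> d; apply/andP; split; first by near: d; exact: nbhs_right_gt.
      by near: d; apply: nbhs_right_lt; rewrite divr_gt0.
    move=> [x' d] /= [xx' /andP[d0 dr]] p' h1 h2.
    have b1 : ball x r x' by apply: le_ball xx'; rewrite ler_pdivrMr//; lra.
    have b2 : ball x r (p', x'.2).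
      case: xx' => [[/= a1 a2] [/= a3 a4]].
      rewrite /ball/= in a1 a2 a3 a4.
      split; split => /=.
      - rewrite /ball/= (_ : x.1.1 - p'.1 = (x.1.1 - x'.1.1) + (x'.1.1 - p'.1)); last by ring.
        by apply: le_lt_trans (ler_normD _ _) _; lra.
      - rewrite /ball/= (_ : x.1.2 - p'.2 = (x.1.2 - x'.1.2) + (x'.1.2 - p'.2)); last by ring.
        by apply: le_lt_trans (ler_normD _ _) _; lra.
      - by apply: lt_trans a3 _; lra.
      - by apply: lt_trans a4 _; lra.
    have := hr _ b1; have := hr _ b2; rewrite /= => e1 e2.
    rewrite (_ : F x'.1 x'.2 - F p' x'.2 =
      (F x.1 x.2 - F p' x'.2) - (F x.1 x.2 - F x'.1 x'.2)); last by ring.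
    by apply: le_trans (ler_normB _ _) _; lra.
  move=> h /(_ h) hn.
  near (0 : R)^'+ => d.
  by exists d; [near: d; exact: nbhs_right_gt|near: d; exact: hn].
exists d => // p p' pM1 pM2 h1 h2 q.
pose l := `|q.1| + `|q.2|.
have l0 : 0 <= l by rewrite addr_ge0.
(* Homogeneity reduces the claim to the unit sphere of the 1-norm, except at [q = 0], where the
   growth bounds settle it. *)
move: l0; rewrite le_eqVlt => /predU1P[l0|l0].
  have := (Fbnd p q).2; have := (Fbnd p' q).1.
  have := enorm_le_sum q; rewrite -/l -l0 => h.
  have -> : enorm q = 0 by apply/eqP; rewrite eq_le h sqrtr_ge0.
  rewrite !mulr0 => h3 h4; apply: le_trans h4 _; apply: mulr_ge0 => //; lra.
pose q' := (l^-1 * q.1, l^-1 * q.2).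
have qE : q = (l * q'.1, l * q'.2).
  by rewrite /q' /= !mulrA divff ?gt_eqF// !mul1r; case: (q).
have nq' : `|q'.1| + `|q'.2| = 1.
  rewrite /q' /= !normrM (@ger0_norm _ l^-1) ?invr_ge0 ?ltW// -mulrDr -/l mulVf//.
  by rewrite gt_eqF.
suff : F p q' <= (1 + e) * F p' q'.
  move=> h; have := ler_wpM2l (ltW l0) h.
  by rewrite mulrCA -(Fhom p q')// -(Fhom p' q')// -qE.
have Kq : K (p, q').
  have := normr_ge0 q'.1; have := normr_ge0 q'.2 => ? ?.
  by split; split; rewrite /= in_itv/= -ler_norml//; lra.
have := dP _ Kq p' h1 h2; rewrite /= ler_norml => /andP[_].
have := (Fbnd p' q').1.
have := normr_fst_enorm q'; have := normr_snd_enorm q' => n2 n1 f1 f2.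
have en : 2^-1 <= enorm q' by lra.
have a1 : e * (m1 * 2^-1) <= e * (m1 * enorm q') by rewrite !ler_pM2l.
have a2 : e * (m1 * enorm q') <= e * F p' q' by rewrite ler_pM2l.
rewrite /eta in f2; lra.
Unshelve. all: by end_near. Qed.

(** * Energy and area on the arcs of a partition *)

Section energy.
Variables u v : R -> R * R.
Hypothesis uv : W11 u v.

Let p1 := W11_primitive1 uv.
Let p2 := W11_primitive2 uv.

Lemma energy_measurable (a b : R) : a <= b ->
  measurable_fun `[a, b] (fun t => F (u t) (v t)).
Proof.
move=> ab.
have [mu1 mu2] := W11_measurable_curve uv (measurable_itv `[a, b]).
have [mv1 mv2] := W11_measurable_derivative uv ab.
have := measurable_continuous_comp4 (measurable_itv `[a, b]) Fcont mu1 mu2 mv1 mv2.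
apply: eq_measurable_fun => t _ /=.
by rewrite -!surjective_pairing.
Qed.

Lemma energy_integrable a b : a <= b ->
  mu.-integrable `[a, b] (EFin \o (fun t => F (u t) (v t))).
Proof.
move=> ab.
apply: (@integrable_dominated _ _ (fun t => m2 * (`|(v t).1| + `|(v t).2|))).
- exact: energy_measurable.
- move=> t _; rewrite ger0_norm; last exact: integrand_ge0.
  by apply: le_trans (Fbnd _ _).2 _; rewrite ler_pM2l// enorm_le_sum.
- exact: (W11_derivative_integrable uv).
Qed.

Lemma Fcal_Rintegral : Fcal F u v = (\int[mu]_(t in `[0, 1]) F (u t) (v t))%:E.
Proof. by rewrite -Rintegral_EFin//; exact: energy_integrable. Qed.

Let Phi a b := \int[mu]_(t in `[a, b]) F (u t) (v t).

Lemma energy_ge0 a b : 0 <= Phi a b.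
Proof. by apply: Rintegral_ge0 => t _; exact: integrand_ge0. Qed.

(** Through [m1], energy controls length and hence oscillation; this is the source of the Lipschitz
    constants of the reparametrized curves. *)
Lemma increment_le_energy a b : a <= b ->
  `|(u b).1 - (u a).1| <= m1^-1 * Phi a b /\ `|(u b).2 - (u a).2| <= m1^-1 * Phi a b.
Proof.
move=> ab; have [i1 ->] := p1 ab; have [i2 ->] := p2 ab.
have iF := energy_integrable ab.
have iF' : mu.-integrable `[a, b] (EFin \o (fun t => m1^-1 * F (u t) (v t))).
  exact: integrable_scale.
rewrite /Phi -RintegralZl//; split; apply: le_trans (le_normr_Rintegral _ _) _ => //;
  apply: le_Rintegral => //; try exact: integrable_norm; move=> t _;
  rewrite ler_pdivlMl//; apply: le_trans (Fbnd _ _).1; rewrite ler_pM2l//.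
- exact: normr_fst_enorm.
- exact: normr_snd_enorm.
Qed.

(** The linear functional supporting [F p] at the total increment integrates along [v] to exactly
    [F p] of that increment. Below the integral sign it is dominated by [F p (v t)], and the
    hypothesis then moves the base point to [u t]. *)
Lemma increment_jensen a b p e : a <= b -> 0 <= 1 + e ->
  (forall t q, t \in `[a, b] -> F p q <= (1 + e) * F (u t) q) ->
  F p ((u b).1 - (u a).1, (u b).2 - (u a).2) <= (1 + e) * Phi a b.
Proof.
move=> ab e0 h; have [i1 E1] := p1 ab; have [i2 E2] := p2 ab.
have iF := energy_integrable ab.
have iF' : mu.-integrable `[a, b] (EFin \o (fun t => (1 + e) * F (u t) (v t))).
  exact: integrable_scale.
have [c [d [sub eq]]] := integrand_subgradient p
  ((u b).1 - (u a).1, (u b).2 - (u a).2).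
have j1 : mu.-integrable `[a, b] (EFin \o (fun t => c * (v t).1)).
  exact: integrable_scale.
have j2 : mu.-integrable `[a, b] (EFin \o (fun t => d * (v t).2)).
  exact: integrable_scale.
rewrite -eq /= E1 E2 /Phi (Rintegral_scale c i1) (Rintegral_scale d i2) (Rintegral_scale _ iF).
rewrite -RintegralD//.
apply: le_Rintegral => // [|t tab]; first exact: (integrableD _ j1 j2).
by apply: le_trans (sub (v t)) _; apply: h; rewrite inE in tab *.
Qed.

(** Replacing [u t] by the constant [p] changes the area integrand by at most [eta * enorm (v t)],
    which [m1] converts into energy. *)
Lemma increment_area a b (p : R * R) eta : a <= b ->
  (forall t, t \in `[a, b] -> `|(u t).1 - p.1| <= eta /\ `|(u t).2 - p.2| <= eta) ->
  `|\int[mu]_(t in `[a, b]) area_integrand u v t -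
    2^-1 * (p.1 * - ((u b).2 - (u a).2) + p.2 * ((u b).1 - (u a).1))|
    <= eta / m1 * Phi a b.
Proof.
move=> ab h; have [i1 E1] := p1 ab; have [i2 E2] := p2 ab.
have iF := energy_integrable ab.
have iF' : mu.-integrable `[a, b] (EFin \o (fun t => (eta / m1) * F (u t) (v t))).
  exact: integrable_scale.
have iA := area_integrable uv ab.
have j1 : mu.-integrable `[a, b] (EFin \o (fun t => (2^-1 * p.2) * (v t).1)).
  exact: integrable_scale.
have j2 : mu.-integrable `[a, b] (EFin \o (fun t => (2^-1 * p.1) * (v t).2)).
  exact: integrable_scale.
have j3 : mu.-integrable `[a, b] (EFin \o
   (fun t => (2^-1 * p.2) * (v t).1 - (2^-1 * p.1) * (v t).2)).
  exact: integrable_sub.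
have j4 : mu.-integrable `[a, b] (EFin \o
   (fun t => area_integrand u v t - ((2^-1 * p.2) * (v t).1 - (2^-1 * p.1) * (v t).2))).
  exact: integrable_sub.
rewrite E1 E2.
rewrite (_ : 2^-1 * _ = (2^-1 * p.2) * \int[mu]_(t in `[a, b]) (v t).1 -
   (2^-1 * p.1) * \int[mu]_(t in `[a, b]) (v t).2); last by ring.
rewrite (Rintegral_scale _ i1) (Rintegral_scale _ i2) /Phi (Rintegral_scale _ iF).
rewrite -!RintegralB//.
apply: le_trans (le_normr_Rintegral _ _) _ => //.
apply: le_Rintegral => //; first exact: integrable_norm.
move=> t tab.
have [h1 h2] : `|(u t).1 - p.1| <= eta /\ `|(u t).2 - p.2| <= eta.
  by apply: h; rewrite inE in tab *.
have n1 := normr_fst_enorm (v t); have n2 := normr_snd_enorm (v t).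
have eta0 : 0 <= eta by apply: le_trans h1.
rewrite (_ : area_integrand u v t - _ =
  2^-1 * (((u t).2 - p.2) * (v t).1 - ((u t).1 - p.1) * (v t).2)); last first.
  by rewrite /area_integrand; ring.
rewrite normrM (@ger0_norm _ 2^-1) ?invr_ge0//.
have := ler_normB (((u t).2 - p.2) * (v t).1) (((u t).1 - p.1) * (v t).2).
rewrite !normrM => le1.
have a1 := ler_pM (normr_ge0 _) (normr_ge0 _) h1 n2.
have a2 := ler_pM (normr_ge0 _) (normr_ge0 _) h2 n1.
apply: (@le_trans _ _ (eta * enorm (v t))); first lra.
rewrite -mulrA; apply: ler_wpM2l => //.
by rewrite ler_pdivlMl//; exact: (Fbnd _ _).1.
Qed.

Lemma partition_energy (N : nat) (s : nat -> R) (e : R) :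
  (forall k, (k < N)%N -> s k <= s k.+1) -> s 0%N = 0 -> s N = 1 -> 0 <= 1 + e ->
  (forall k t q, (k < N)%N -> t \in `[s k, s k.+1] ->
    F (u (s k)) q <= (1 + e) * F (u t) q) ->
  \sum_(k < N) F (u (s k))
     ((u (s k.+1)).1 - (u (s k)).1, (u (s k.+1)).2 - (u (s k)).2) <= (1 + e) * Phi 0 1.
Proof.
move=> smono s0 sN e0 h.
rewrite /Phi (Rintegral_partition smono s0 sN); last exact: energy_integrable.
rewrite mulr_sumr; apply: ler_sum => k _.
by apply: increment_jensen => // [|t q]; [exact: smono|exact: h].
Qed.

Lemma partition_area (N : nat) (s : nat -> R) (eta : R) :
  (forall k, (k < N)%N -> s k <= s k.+1) -> s 0%N = 0 -> s N = 1 ->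
  (forall k t, (k < N)%N -> t \in `[s k, s k.+1] ->
    `|(u t).1 - (u (s k)).1| <= eta /\ `|(u t).2 - (u (s k)).2| <= eta) ->
  `|\int[mu]_(t in `[0, 1]) area_integrand u v t -
    \sum_(k < N) 2^-1 * ((u (s k)).1 * - ((u (s k.+1)).2 - (u (s k)).2) +
                         (u (s k)).2 * ((u (s k.+1)).1 - (u (s k)).1))|
    <= eta / m1 * Phi 0 1.
Proof.
move=> smono s0 sN h.
rewrite /Phi !(Rintegral_partition smono s0 sN); last 2 first.
- exact: energy_integrable.
- exact: area_integrable.
rewrite -sumrB mulr_sumr; apply: le_trans (ler_norm_sum _ _ _) _.
apply: ler_sum => k _; apply: increment_area => [|t]; [exact: smono|exact: h].
Qed.

End energy.

(** * Reparametrization by energy *)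

Section reparametrization.
Variables u v : R -> R * R.
Hypothesis uv : W11 u v.

Let Phi a b := \int[mu]_(t in `[a, b]) F (u t) (v t).
Let E := Phi 0 1.
Let C := (E + 1) / m1.

(** In [C], the numerator is the length of the range of the energy parameter, and [m1] converts
    energy into length. The hypothesis of the fourth clause concerns values of [u], because Jensen's
    inequality is applied along arcs of [u]. *)
Lemma reparametrization : exists w : R -> R * R,
  [/\ w 0 = u 0, w 1 = u 0,
      forall x y, 0 <= x -> x <= y -> y <= 1 ->
        `|(w y).1 - (w x).1| <= C * (y - x) /\ `|(w y).2 - (w x).2| <= C * (y - x),
      forall N e, (0 < N)%N -> 0 <= e ->
        (forall t t' q, 0 <= t <= 1 -> 0 <= t' <= 1 ->
          `|(u t).1 - (u t').1| <= C / N%:R -> `|(u t).2 - (u t').2| <= C / N%:R ->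
          F (u t) q <= (1 + e) * F (u t') q) ->
        polygon_energy F w N <= (1 + e) * E &
      forall N, (0 < N)%N ->
        `|\int[mu]_(t in `[0, 1]) area_integrand u v t - polygon_area w N|
        <= C / N%:R / m1 * E].
Proof.
have Phi_ge0 a b : 0 <= Phi a b by exact: (energy_ge0 u v).
have Phi_split a b c : a <= b -> b <= c -> Phi a c = Phi a b + Phi b c.
  move=> ab bc; apply: Rintegral_itv_split => //.
  by apply: (energy_integrable uv); exact: le_trans bc.
have E0 : 0 <= E := Phi_ge0 0 1.
(* The term [t] makes [psi] strictly increasing where the energy vanishes. *)
pose psi t := Phi 0 t + t.
have psi0 : psi 0 = 0 by rewrite /psi /Phi set_itv1 Rintegral_set1 addr0.
have psi1 : psi 1 = E + 1 by [].
have psiB s t : 0 <= s -> s <= t -> psi t - psi s = Phi s t + (t - s).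
  by move=> s0 st; rewrite /psi (Phi_split 0 s t)//; ring.
have psi_cont : {within `[0, 1], continuous psi}.
  have cid : {within `[0, 1], continuous (fun x : R => x)}.
    by apply: continuous_subspaceT => x; exact: cvg_id.
  move=> t; apply: cvgD; last exact: cid.
  exact: (parameterized_integral_continuous ler01
    (energy_integrable uv ler01)).
(* A right inverse of [psi], rescaled to the unit interval, from the intermediate value theorem;
   outside that interval the value [0] is arbitrary. *)
have /choice[T TP] x : exists t, 0 <= x <= 1 -> 0 <= t <= 1 /\ psi t = x * (E + 1).
  have [x01|] := boolP (0 <= x <= 1); last by move=> nx; exists 0.
  have [] := @IVT R psi 0 1 (x * (E + 1)) ler01 psi_cont.
    have le1 : psi 0 <= psi 1 by rewrite psi0 psi1; lra.
    rewrite (min_idPl le1) (max_idPr le1) psi0 psi1.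
    by case/andP: x01 => x0 x1; apply/andP; split; [nra|nra].
  by move=> t; rewrite in_itv/= => t01 te; exists t.
have psi_inc s t : 0 <= s -> s < t -> psi s < psi t.
  by move=> s0 st; have := psiB s t s0 (ltW st); have := Phi_ge0 s t; lra.
have T_mono x y : 0 <= x -> x <= y -> y <= 1 -> T x <= T y.
  move=> x0 xy y1.
  have [|/andP[Tx0 Tx1] ex] := TP x; first by apply/andP; split => //; exact: le_trans y1.
  have [|/andP[Ty0 Ty1] ey] := TP y; first by apply/andP; split => //; exact: le_trans xy.
  rewrite leNgt; apply/negP => lt; have := psi_inc _ _ Ty0 lt; rewrite ex ey.
  by apply/negP; rewrite -leNgt ler_wpM2r//; lra.
have T0 : T 0 = 0.
  have [|/andP[Tx0 Tx1] ex] := TP 0; first by rewrite lexx ler01.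
  apply/eqP; rewrite eq_le Tx0 andbT leNgt; apply/negP => lt.
  by have := psi_inc _ _ (lexx 0) lt; rewrite ex psi0 mul0r ltxx.
have T1 : T 1 = 1.
  have [|/andP[Tx0 Tx1] ex] := TP 1; first by rewrite lexx ler01.
  apply/eqP; rewrite eq_le Tx1 leNgt; apply/negP => lt.
  by have := psi_inc _ _ Tx0 lt; rewrite ex psi1 mul1r ltxx.
have PhiT x y : 0 <= x -> x <= y -> y <= 1 -> Phi (T x) (T y) <= (E + 1) * (y - x).
  move=> x0 xy y1.
  have [|/andP[Tx0 Tx1] ex] := TP x; first by apply/andP; split => //; exact: le_trans y1.
  have [|/andP[Ty0 Ty1] ey] := TP y; first by apply/andP; split => //; exact: le_trans xy.
  have := psiB _ _ Tx0 (T_mono _ _ x0 xy y1); rewrite ex ey.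
  have := T_mono _ _ x0 xy y1; lra.
have incr s t := increment_le_energy uv (a := s) (b := t).
have CE d : C * d = m1^-1 * ((E + 1) * d) by rewrite /C; ring.
have im1 : 0 <= m1^-1 by rewrite invr_ge0 ltW.
have grid N k : (0 < N)%N -> (k < N)%N -> [/\ 0 <= k%:R / N%:R :> R,
    k%:R / N%:R <= k.+1%:R / N%:R :> R, k.+1%:R / N%:R <= 1 :> R &
    k.+1%:R / N%:R - k%:R / N%:R = N%:R^-1 :> R].
  move=> N0 kN; have N0' : 0 < N%:R :> R by rewrite ltr0n.
  split.
  - by rewrite divr_ge0.
  - by rewrite ler_pM2r ?invr_gt0// ler_nat.
  - by rewrite ler_pdivrMr// mul1r ler_nat.
  - by rewrite -mulrBl -natrB// subSnn mul1r.
have s0 N : T (0%:R / N%:R) = 0 by rewrite mul0r.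
have sN N : (0 < N)%N -> T (N%:R / N%:R) = 1.
  by move=> N0; rewrite divff ?pnatr_eq0 -?lt0n.
have smono N : (0 < N)%N -> forall k, (k < N)%N -> T (k%:R / N%:R) <= T (k.+1%:R / N%:R).
  by move=> N0 k kN; have [? ? ? ?] := grid N k N0 kN; exact: T_mono.
have close N k t : (0 < N)%N -> (k < N)%N ->
    t \in `[T (k%:R / N%:R), T (k.+1%:R / N%:R)] ->
    `|(u t).1 - (u (T (k%:R / N%:R))).1| <= C / N%:R /\
    `|(u t).2 - (u (T (k%:R / N%:R))).2| <= C / N%:R.
  move=> N0 kN; rewrite in_itv/= => /andP[t1 t2].
  have [g1 g2 g3 g4] := grid N k N0 kN.
  have [h1 h2] := incr _ _ t1.
  have h : m1^-1 * Phi (T (k%:R / N%:R)) t <= C / N%:R.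
    rewrite CE ler_wpM2l//; have := PhiT _ _ g1 g2 g3; rewrite g4; apply: le_trans.
    by rewrite (Phi_split _ _ _ t1 t2) lerDl.
  by split; [exact: le_trans h1 h|exact: le_trans h2 h].
exists (u \o T); split => /=.
- by rewrite T0.
- by rewrite T1 -[in LHS](add0r 1) (proj1 uv).
- move=> x y x0 xy y1.
  have [h1 h2] := incr _ _ (T_mono _ _ x0 xy y1).
  have h := ler_wpM2l im1 (PhiT _ _ x0 xy y1).
  by rewrite CE; split; [exact: le_trans h1 h|exact: le_trans h2 h].
- move=> N e N0 e0 h.
  apply: (partition_energy uv
    (s := fun k => T (k%:R / N%:R))); [exact: smono|exact: s0|exact: sN|lra|].
  move=> k t q kN tk; have [c1 c2] := close _ _ _ N0 kN tk.
  have [g1 g2 g3 g4] := grid N k N0 kN.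
  have [|k01 _] := TP (k%:R / N%:R).
    by apply/andP; split => //; exact: le_trans g3.
  have [|k01' _] := TP (k.+1%:R / N%:R).
    by apply/andP; split => //; exact: le_trans g2.
  move: tk; rewrite in_itv/= => /andP[t1 t2].
  apply: h => //; [|by rewrite distrC|by rewrite distrC].
  case/andP: k01 => a1 a2; case/andP: k01' => b1 b2.
  by rewrite (le_trans a1 t1) (le_trans t2 b2).
- move=> N N0.
  apply: (partition_area uv
    (s := fun k => T (k%:R / N%:R))); [exact: smono|exact: s0|exact: sN|].
  by move=> k t kN tk; exact: close.
Qed.

End reparametrization.

(** * Lower semicontinuity along inscribed polygons *)

Section lower_semicontinuity.
Variables W v : R -> R * R.
Hypothesis Wv : W11 W v.
Variable L : R.
Hypothesis lip1 : forall s t, `|(W s).1 - (W t).1| <= L * `|s - t|.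
Hypothesis lip2 : forall s t, `|(W s).2 - (W t).2| <= L * `|s - t|.
Hypothesis slope1 : {ae mu, forall t, has_slope (fun s => (W s).1) t (v t).1}.
Hypothesis slope2 : {ae mu, forall t, has_slope (fun s => (W s).2) t (v t).2}.

(** The density whose integral over the unit interval is [polygon_energy F W n.+1]: a step function
    built from difference quotients. The base point is split into components to fit
    [measurable_continuous_comp4] and [continuous_cvg4]. *)
Definition polygon_step n t : R := F ((W (grid_approx n t)).1, (W (grid_approx n t)).2)
  (n.+1%:R * ((W (grid_approx n t + n.+1%:R^-1)).1 - (W (grid_approx n t)).1),
   n.+1%:R * ((W (grid_approx n t + n.+1%:R^-1)).2 - (W (grid_approx n t)).2)).

Let c1 : continuous (fun t => (W t).1) := lipschitz_continuous lip1.
Let c2 : continuous (fun t => (W t).2) := lipschitz_continuous lip2.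

Lemma polygon_step_ge0 n t : 0 <= polygon_step n t.
Proof. exact: integrand_ge0. Qed.

Lemma polygon_step_measurable n (D : set R) : measurable D -> measurable_fun D (polygon_step n).
Proof.
move=> mD.
have mg : measurable_fun D (@grid_approx R n).
  by apply: nondecreasing_measurable => //; exact: grid_approx_mono.
have mc (f : R -> R) : continuous f -> measurable_fun D (fun t => f (grid_approx n t)).
  by move=> cf; apply: (measurableT_comp _ mg); exact: continuous_measurable_fun.
have mc' (f : R -> R) : continuous f ->
    measurable_fun D (fun t => n.+1%:R * (f (grid_approx n t + n.+1%:R^-1) - f (grid_approx n t))).
  move=> cf; apply: (mc (fun x => n.+1%:R * (f (x + n.+1%:R^-1) - f x))) => t.
  apply: cvgMr; apply: cvgB; last exact: cf.
  apply: (@cvg_comp _ _ _ (fun t => t + n.+1%:R^-1) f _ (nbhs (t + n.+1%:R^-1))); last exact: cf.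
  by apply: cvgD; [exact: cvg_id|exact: cvg_cst].
exact: (measurable_continuous_comp4 mD Fcont (mc _ c1) (mc _ c2) (mc' _ c1) (mc' _ c2)).
Qed.

Lemma polygon_step_integrable n a b : mu.-integrable `[a, b] (EFin \o polygon_step n).
Proof.
apply: (@integrable_dominated _ _ (fun=> m2 * (L + L))); last exact: integrable_itv_cst.
  exact: polygon_step_measurable.
move=> t _; rewrite ger0_norm ?polygon_step_ge0//; apply: le_trans (Fbnd _ _).2 _.
rewrite ler_pM2l//; apply: le_trans (enorm_le_sum _) _ => /=.
have key (f : R -> R) : (forall s t, `|f s - f t| <= L * `|s - t|) ->
    `|n.+1%:R * (f (grid_approx n t + n.+1%:R^-1) - f (grid_approx n t))| <= L.
  move=> lip; rewrite normrM ger0_norm// -ler_pdivlMl//.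
  apply: le_trans (lip _ _) _.
  by rewrite addrAC subrr add0r ger0_norm ?invr_ge0// mulrC.
by apply: lerD; [exact: (key (fun s => (W s).1))|exact: (key (fun s => (W s).2))].
Qed.

Lemma polygon_step_integral n : \int[mu]_(t in `[0, 1]) polygon_step n t = polygon_energy F W n.+1.
Proof.
have n0 : n.+1%:R != 0 :> R by rewrite pnatr_eq0.
rewrite (@Rintegral_partition _ _ n.+1 (fun k => k%:R / n.+1%:R)); last first.
- exact: polygon_step_integrable.
- by rewrite divff.
- by rewrite mul0r.
- by move=> k _; rewrite ler_pM2r ?invr_gt0// ler_nat.
apply: eq_bigr => k _.
(* The right endpoint is removed because [grid_approx] already jumps to the next node there; on the
   half-open piece the integrand is constant. *)
rewrite -Rintegral_itv_bndo_bndc; last first.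
  apply: integrableS (polygon_step_integrable n (k%:R / n.+1%:R) (k.+1%:R / n.+1%:R)) => //.
  by apply: subset_itv; rewrite bnd_simp.
have kE : k%:R / n.+1%:R + n.+1%:R^-1 = k.+1%:R / n.+1%:R :> R.
  by rewrite -[X in _ + X]mul1r -mulrDl natr1.
pose c := n.+1%:R * F (W (k%:R / n.+1%:R))
    ((W (k.+1%:R / n.+1%:R)).1 - (W (k%:R / n.+1%:R)).1,
     (W (k.+1%:R / n.+1%:R)).2 - (W (k%:R / n.+1%:R)).2).
transitivity (\int[mu]_(t in `[k%:R / n.+1%:R, k.+1%:R / n.+1%:R[) c).
  apply: (@eq_Rintegral _ _ R mu) => t; rewrite inE/= in_itv/= => tk.
  rewrite /polygon_step (grid_approxE tk) kE /c -Fhom//=; congr F.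
  by case: (W (k%:R / n.+1%:R)).
rewrite Rintegral_itv_bndo_bndc; last first.
  apply: integrableS (integrable_itv_cst (k%:R / n.+1%:R) (k.+1%:R / n.+1%:R) c) => //.
  by apply: subset_itv; rewrite bnd_simp.
rewrite Rintegral_itv_cst; last by rewrite ler_pM2r ?invr_gt0// ler_nat.
have -> : k.+1%:R / n.+1%:R - k%:R / n.+1%:R = n.+1%:R^-1 :> R.
  by rewrite -kE addrAC subrr add0r.
by rewrite /c mulrAC divff// mul1r.
Qed.

Lemma polygon_step_cvg : {ae mu, forall t, polygon_step n t @[n --> \oo] --> F (W t) (v t)}.
Proof.
have : {ae mu, forall t, has_slope (fun s => (W s).1) t (v t).1 /\
    has_slope (fun s => (W s).2) t (v t).2}.
  exact: ae_and slope1 slope2.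
apply: ae_impl => t [s1 s2].
have g1 : (W (grid_approx n t)).1 @[n --> \oo] --> (W t).1.
  apply: (@cvg_comp _ _ _ (fun n => grid_approx n t) (fun s => (W s).1) _ (nbhs t)).
    exact: cvg_grid_approx.
  exact: c1.
have g2 : (W (grid_approx n t)).2 @[n --> \oo] --> (W t).2.
  apply: (@cvg_comp _ _ _ (fun n => grid_approx n t) (fun s => (W s).2) _ (nbhs t)).
    exact: cvg_grid_approx.
  exact: c2.
have -> : F (W t) (v t) = F ((W t).1, (W t).2) ((v t).1, (v t).2).
  by rewrite -!surjective_pairing.
exact: (continuous_cvg4 _ Fcont g1 g2 (has_slope_grid s1) (has_slope_grid s2)).
Qed.

Lemma energy_le_polygon (B : R) :
  (forall e, 0 < e -> \forall n \near \oo, polygon_energy F W n.+1 <= B + e) ->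
  (Fcal F W v <= B%:E)%E.
Proof.
move=> hB.
have ms n : measurable_fun (`[0, 1]%classic : set R) (EFin \o polygon_step n).
  by apply/measurable_EFinP; exact: polygon_step_measurable.
have fat := @fatou _ _ _ mu _ (measurable_itv `[0, 1]) _ ms
  (fun n t _ => polygon_step_ge0 n t).
have mF : measurable_fun (`[0, 1]%classic : set R) (EFin \o (fun t => F (W t) (v t))).
  by apply/measurable_EFinP; exact: (energy_measurable Wv ler01).
have ml : measurable_fun (`[0, 1]%classic : set R) (fun t => limn_einf (fun n => (polygon_step n t)%:E)).
  rewrite /limn_einf; apply: measurableT_comp => //.
  apply: measurable_fun_limn_esup => n.
  by apply: (measurableT_comp _ (ms n)).
have le1 : (Fcal F W v <= \int[mu]_(t in `[0%R, 1%R]) limn_einf (fun n => (polygon_step n t)%:E))%E.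
  apply: ae_ge0_le_integral => //.
  - by move=> t _; rewrite lee_fin; exact: integrand_ge0.
  - move=> t _; rewrite limn_einf_lim; apply: lime_ge; first exact: is_cvg_einfs.
    apply: nearW => n; apply: le_ereal_inf_tmp => _ [k _ <-].
    by rewrite lee_fin polygon_step_ge0.
  - apply: ae_impl polygon_step_cvg => t st _.
    have : (polygon_step n t)%:E @[n --> \oo] --> (F (W t) (v t))%:E.
      by apply: cvg_EFin; [exact: nearW|exact: st].
    by move=> /cvg_limn_einf_sup[-> _].
apply: (le_trans le1); apply: (le_trans fat).
apply/lee_addgt0Pr => e e0; apply: limn_einf_le.
apply: filterS (hB e e0) => n; rewrite -EFinD -lee_fin -polygon_step_integral => h.
by rewrite [leLHS]Rintegral_EFin//; exact: polygon_step_integrable.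
Qed.

End lower_semicontinuity.

(** * Passage to the limit *)

Section existence.
Hypothesis Fper : forall (p q : R * R) (n1 n2 : int),
  F (p.1 + n1%:~R, p.2 + n2%:~R) q = F p q.

Variables tau s : R.
Hypothesis s_ge0 : 0 <= s.

(** Named so that the polygon bounds can be stated for all admissible [e] and [d] and carried to the
    limit before either is chosen. *)
Definition modulus (M e d : R) := forall p p' : R * R, `|p.1| <= M -> `|p.2| <= M ->
  `|p.1 - p'.1| <= d -> `|p.2 - p'.2| <= d -> forall q, F p q <= (1 + e) * F p' q.

(** A competitor with energy [E < s + eta] and [eta <= 1] has [(E + 1) / m1 <= C], uniformly along
    the minimizing sequence. The bound [M] adds to this displacement the size, at most [1], of the
    coordinates of the normalized starting point. *)
Let C := (s + 2) / m1.
Let M := 1 + C.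

Lemma almost_minimizer (eta : R) (u v : R -> R * R) : eta <= 1 ->
  W11 u v -> Acal u v = tau%:E -> (Fcal F u v < (s + eta)%:E)%E ->
  exists w : R -> R * R,
  [/\ w 0 = w 1,
      forall x, 0 <= x <= 1 -> `|(w x).1| <= M /\ `|(w x).2| <= M,
      forall x y, 0 <= x -> x <= y -> y <= 1 ->
        `|(w y).1 - (w x).1| <= C * (y - x) /\ `|(w y).2 - (w x).2| <= C * (y - x),
      forall N e d, (0 < N)%N -> 0 <= e -> C / N%:R <= d -> modulus M e d ->
        polygon_energy F w N <= (1 + e) * (s + eta) &
      forall N, (0 < N)%N ->
        `|tau - polygon_area w N| <= C / N%:R / m1 * (s + 1)].
Proof.
move=> eta1 uv0 A0 E0.
pose k1 := - Num.floor (u 0).1; pose k2 := - Num.floor (u 0).2.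
have [uv] := W11_translate k1%:~R k2%:~R uv0; rewrite {}A0.
set u' := fun t => _ in uv * => A1.
have E1 : (Fcal F u' v < (s + eta)%:E)%E.
  by apply: le_lt_trans E0; rewrite /Fcal /u' le_eqVlt; apply/orP; left; apply/eqP;
    apply: eq_integral => t _; rewrite Fper.
have n0 : `|(u' 0).1| <= 1 /\ `|(u' 0).2| <= 1.
  rewrite /u' /k1 /k2 /= !rmorphN /= -/(frac _) -/(frac _).
  have /andP[? ?] := frac_itv (u 0).1; have /andP[? ?] := frac_itv (u 0).2.
  by rewrite !ger0_norm// !ltW.
move: E1; rewrite (Fcal_Rintegral uv) lte_fin.
set E := Rintegral _ _ _ => E1.
have Ege0 : 0 <= E by exact: (energy_ge0 u' v).
move: A1; rewrite Acal_Rintegral// => -[A1].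
have CC : (E + 1) / m1 <= C by rewrite /C ler_pM2r ?invr_gt0//; lra.
have C0 : 0 <= C by rewrite /C divr_ge0 ?ltW//; lra.
have [w [w0 w1 wlip wF wA]] :=
  reparametrization uv.
rewrite -/E in wlip wF wA.
have wlipC x y : 0 <= x -> x <= y -> y <= 1 ->
    `|(w y).1 - (w x).1| <= C * (y - x) /\ `|(w y).2 - (w x).2| <= C * (y - x).
  move=> x0 xy y1; have [h1 h2] := wlip x y x0 xy y1.
  have h : (E + 1) / m1 * (y - x) <= C * (y - x) by rewrite ler_wpM2r ?subr_ge0.
  by split; [exact: le_trans h1 h|exact: le_trans h2 h].
have bound (a b x : R) : `|a| <= 1 -> `|b - a| <= x -> x <= C -> `|b| <= M.
  move=> ha hb hx; rewrite -(subrK a b) addrC; apply: le_trans (ler_normD _ _) _.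
  by rewrite /M lerD// (le_trans hb).
have uM t : 0 <= t <= 1 -> `|(u' t).1| <= M /\ `|(u' t).2| <= M.
  (* The modulus is applied to points of [u'], so the box bound is needed for [u'] as well as for
     [w]. *)
  case/andP=> t0 t1.
  have [h1 h2] := increment_le_energy uv t0.
  have h : m1^-1 * \int[mu]_(t in `[0, t]) F (u' t) (v t) <= C.
    apply: le_trans CC; rewrite mulrC ler_pM2r ?invr_gt0//.
    rewrite /E (Rintegral_itv_split t0 t1); last first.
      exact: (energy_integrable uv ler01).
    have := energy_ge0 u' v t 1; lra.
  by split; [exact: bound n0.1 h1 h|exact: bound n0.2 h2 h].
have CN N : (E + 1) / m1 / N%:R <= C / N%:R.
  by apply: ler_wpM2r => //; rewrite invr_ge0.
exists w; split => //.
- by rewrite w0 w1.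
- move=> x /andP[x0 x1]; have [h1 h2] := wlipC 0 x (lexx 0) x0 x1.
  have h : C * (x - 0) <= C by rewrite subr0 ler_piMr.
  by rewrite w0 in h1 h2; split; [exact: bound n0.1 h1 h|exact: bound n0.2 h2 h].
- move=> N e d N0 e0 Cd md.
  apply: (@le_trans _ _ ((1 + e) * E)); last by apply: ler_wpM2l; lra.
  apply: wF => // t t' q t01 t01' h1 h2.
  have [? ?] := uM t t01.
  apply: md => //; [apply: le_trans h1 _|apply: le_trans h2 _];
    exact: le_trans (CN N) Cd.
- move=> N N0; rewrite -A1; apply: le_trans (wA N N0) _.
  apply: ler_pM => //.
  + by rewrite !divr_ge0// ?ltW//; lra.
  + by apply: ler_wpM2r (CN N); rewrite invr_ge0 ltW.
  + lra.
Qed.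

Hypothesis s_inf : forall e, 0 < e -> exists u v,
  [/\ W11 u v, Acal u v = tau%:E & (Fcal F u v < (s + e)%:E)%E].

Lemma limit_curve : exists W : R -> R * R,
  [/\ W 0 = W 1,
      forall x y, 0 <= x -> x <= y -> y <= 1 ->
        `|(W y).1 - (W x).1| <= C * (y - x) /\ `|(W y).2 - (W x).2| <= C * (y - x),
      forall N e d, (0 < N)%N -> 0 <= e -> C / N%:R <= d -> modulus M e d ->
        polygon_energy F W N <= (1 + e) * s &
      forall N, (0 < N)%N ->
        `|tau - polygon_area W N| <= C / N%:R / m1 * (s + 1)].
Proof.
have /choice[w wP] : forall n : nat, exists w : R -> R * R,
  [/\ w 0 = w 1,
      forall x, 0 <= x <= 1 -> `|(w x).1| <= M /\ `|(w x).2| <= M,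
      forall x y, 0 <= x -> x <= y -> y <= 1 ->
        `|(w y).1 - (w x).1| <= C * (y - x) /\ `|(w y).2 - (w x).2| <= C * (y - x),
      forall N e d, (0 < N)%N -> 0 <= e -> C / N%:R <= d -> modulus M e d ->
        polygon_energy F w N <= (1 + e) * (s + n.+1%:R^-1) &
      forall N, (0 < N)%N ->
        `|tau - polygon_area w N| <= C / N%:R / m1 * (s + 1)].
  move=> n; have [|u [v [uv A E]]] := s_inf (e := n.+1%:R^-1); first by rewrite invr_gt0.
  by apply: (almost_minimizer _ uv A E); rewrite invf_le1// ler1n.
(* One ultrafilter refining the tail filter gives limits at all [x] simultaneously, in place of a
   diagonal extraction. *)
have [U [UU sU]] := ultraFilterLemma (@eventually_filter).
have PU : ProperFilter U by exact: ultra_proper.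
have /choice[W WP] : forall x, exists p : R * R, 0 <= x <= 1 ->
    (fun n => (w n x).1) @ U --> p.1 /\ (fun n => (w n x).2) @ U --> p.2.
  move=> x; have [x01|nx] := boolP (0 <= x <= 1); last by exists (0, 0).
  have [|l1 h1] := @ultra_cvg_bounded R U (fun n => (w n x).1) M UU.
    by move=> n; have [_ /(_ x x01)[] ] := wP n.
  have [|l2 h2] := @ultra_cvg_bounded R U (fun n => (w n x).2) M UU.
    by move=> n; have [_ /(_ x x01)[] ] := wP n.
  by exists (l1, l2).
have i0 : 0 <= (0 : R) <= 1 by rewrite lexx ler01.
have i1 : 0 <= (1 : R) <= 1 by rewrite lexx ler01.
have grid N (k : 'I_N) : 0 <= (k%:R / N%:R : R) <= 1 /\ 0 <= (k.+1%:R / N%:R : R) <= 1.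
  case: N k => [[]//|N] k.
  have N0 : 0 < N.+1%:R :> R by rewrite ltr0n.
  by rewrite !divr_ge0// !ler_pdivrMr// !mul1r !ler_nat ltn_ord ltnW.
exists W; split.
- have [a1 a2] := WP 0 i0; have [b1 b2] := WP 1 i1.
  have e1 : (fun n => (w n 0).1) = (fun n => (w n 1).1).
    by apply/funext => n; have [->] := wP n.
  have e2 : (fun n => (w n 0).2) = (fun n => (w n 1).2).
    by apply/funext => n; have [->] := wP n.
  rewrite e1 in a1; rewrite e2 in a2.
  rewrite (surjective_pairing (W 0)) (surjective_pairing (W 1)); congr pair.
  + exact: (cvg_unique _ a1 b1).
  + exact: (cvg_unique _ a2 b2).
- move=> x y x0 xy y1.
  have [|a1 a2] := WP x; first by rewrite x0 (le_trans xy).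
  have [|b1 b2] := WP y; first by rewrite y1 (le_trans x0).
  split.
  + apply: (cvg_ler PU (cvg_norm (cvgB b1 a1))) => n.
    by have [_ _ /(_ x y x0 xy y1)[]] := wP n.
  + apply: (cvg_ler PU (cvg_norm (cvgB b2 a2))) => n.
    by have [_ _ /(_ x y x0 xy y1)[]] := wP n.
- move=> N e d N0 e0 Cd md.
  have cE : (fun n => polygon_energy F (w n) N) @ U --> polygon_energy F W N.
    apply: cvg_big => [|k _]; first exact: add_continuous.
    have [g1 g2] := grid N k.
    have [a1 a2] := WP _ g1; have [b1 b2] := WP _ g2.
    rewrite [X in _ --> X](_ : _ = F ((W (k%:R / N%:R)).1, (W (k%:R / N%:R)).2)
      ((W (k.+1%:R / N%:R)).1 - (W (k%:R / N%:R)).1,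
       (W (k.+1%:R / N%:R)).2 - (W (k%:R / N%:R)).2)); last by rewrite -surjective_pairing.
    under eq_fun do rewrite (surjective_pairing (w _ (k%:R / N%:R))).
    exact: (continuous_cvg4 _ Fcont a1 a2 (cvgB b1 a1) (cvgB b2 a2)).
  (* The slack [(1 + e) / n.+1] is moved to the left-hand side, so that the remaining bound
     [(1 + e) * s] is independent of [n]. *)
  have hU : (fun n => (1 + e) * n.+1%:R^-1) @ U --> (1 + e) * 0.
    apply: cvgMr => V nV; apply: sU; exact: (@cvg_harmonic R _ nV).
  have := cvg_ler PU (cvgB cE hU) (c := (1 + e) * s).
  rewrite mulr0 subr0; apply => n.
  have [_ _ _ /(_ N e d N0 e0 Cd md) h _] := wP n.
  by rewrite /= lerBlDr -mulrDr.
- move=> N N0.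
  have cA : (fun n => polygon_area (w n) N) @ U --> polygon_area W N.
    apply: cvg_big => [|k _]; first exact: add_continuous.
    have [g1 g2] := grid N k.
    have [a1 a2] := WP _ g1; have [b1 b2] := WP _ g2.
    apply: cvgMr; apply: cvgD; apply: cvgM => //; last exact: cvgB.
    by apply: cvgN; exact: cvgB.
  apply: (cvg_ler PU (cvg_norm (cvgB (@cvg_cst _ tau _ U _) cA))) => n.
  by have [_ _ _ _ /(_ N N0)] := wP n.
Qed.

Lemma minimizer_exists : exists u v : R -> R * R,
  [/\ W11 u v, lipschitz2 u, Acal u v = tau%:E & (Fcal F u v <= s%:E)%E].
Proof.
have [W [W01 Wlip WF WA]] := limit_curve.
have C0 : 0 <= C by rewrite /C divr_ge0 ?ltW//; have := s_ge0; lra.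
pose u t := W (frac t).
have lip1 : forall a b, `|(u a).1 - (u b).1| <= C * `|a - b|.
  apply: (@periodic_lipschitz _ (fun t => (W t).1)) => //; first by rewrite W01.
  by move=> x y x0 xy y1; have [] := Wlip x y x0 xy y1.
have lip2 : forall a b, `|(u a).2 - (u b).2| <= C * `|a - b|.
  apply: (@periodic_lipschitz _ (fun t => (W t).2)) => //; first by rewrite W01.
  by move=> x y x0 xy y1; have [] := Wlip x y x0 xy y1.
(* At [x = 1] the fractional part is [0], and closedness [W01] recovers the last vertex. *)
have uE x : 0 <= x -> x <= 1 -> u x = W x.
  move=> x0; rewrite le_eqVlt => /predU1P[->|x1].
    by rewrite /u frac1.
  by rewrite /u frac_id// x0.
have [v1 [p1 s1]] := lipschitz_primitive lip1.
have [v2 [p2 s2]] := lipschitz_primitive lip2.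
pose v t := (v1 t, v2 t).
have uv : W11 u v by apply: primitive_W11 => // t; rewrite /u fracD1.
have grid N (k : 'I_N) : [/\ 0 <= (k%:R / N%:R : R), (k%:R / N%:R : R) <= 1,
    0 <= (k.+1%:R / N%:R : R) & (k.+1%:R / N%:R : R) <= 1].
  case: N k => [[]//|N] k.
  have N0 : 0 < N.+1%:R :> R by rewrite ltr0n.
  by split; rewrite ?divr_ge0// ler_pdivrMr// mul1r ler_nat// ltnW.
have peE N : polygon_energy F u N = polygon_energy F W N.
  by apply: eq_bigr => k _; have [? ? ? ?] := grid N k; rewrite !uE.
have paE N : polygon_area u N = polygon_area W N.
  by apply: eq_bigr => k _; have [? ? ? ?] := grid N k; rewrite !uE.
exists u, v; split => //.
- exists (C + C) => a b; apply: le_trans (enorm_le_sum _) _ => /=.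
  by rewrite mulrDl lerD.
- rewrite Acal_Rintegral//; congr EFin; apply/eqP; rewrite -subr_eq0 -normr_le0.
  set A := Rintegral _ _ _; set E := \int[mu]_(t in `[0, 1]) F (u t) (v t).
  have E0 : 0 <= E by exact: (energy_ge0 u v).
  (* [K / N] adds two errors: replacing the area of [u] by that of its polygon, and the polygon area
     bound inherited from the minimizing sequence. *)
  pose K := C / m1 * E + C / m1 * (s + 1).
  have K0 : 0 <= K.
    have := s_ge0 => ?.
    by rewrite /K addr_ge0// mulr_ge0// ?divr_ge0// ?ltW//; lra.
  apply/ler_addgt0Pr => e e0; rewrite add0r.
  pose N := (Num.bound (K / e)).+1.
  have KN : K / e < N%:R.
    apply: lt_trans (archi_boundP _) _; first by rewrite divr_ge0// ltW.
    by rewrite ltr_nat.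
  have N0 : 0 < N%:R :> R by rewrite ltr0n.
  have h1 := WA N isT.
  have h2 : `|A - polygon_area u N| <= C / N%:R / m1 * E.
    apply: (partition_area uv (s := fun k => k%:R / N%:R)).
    + by move=> k _; rewrite ler_pM2r ?invr_gt0// ler_nat.
    + by rewrite mul0r.
    + by rewrite divff// gt_eqF.
    + move=> k t kN; rewrite in_itv/= => /andP[t1 t2].
      have ht : C * `|t - k%:R / N%:R| <= C / N%:R.
        apply: ler_wpM2l => //; rewrite ger0_norm ?subr_ge0// lerBlDr.
        by apply: le_trans t2 _; rewrite -[X in _ <= X + _]mul1r -mulrDl addrC natr1.
      by split; [exact: le_trans (lip1 _ _) ht|exact: le_trans (lip2 _ _) ht].
  rewrite paE in h2.
  have KNe : K / N%:R <= e by rewrite ler_pdivrMr// mulrC -ler_pdivrMr// ltW.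
  have KE : K / N%:R = C / N%:R / m1 * E + C / N%:R / m1 * (s + 1) by rewrite /K; ring.
  rewrite (_ : A - tau = (A - polygon_area W N) - (tau - polygon_area W N)); last by ring.
  by apply: le_trans (ler_normB _ _) _; lra.
- apply: (energy_le_polygon uv lip1 lip2 s1 s2) => e e0.
  have s1' : 0 < s + 1 by have := s_ge0; lra.
  (* With this choice [(1 + e / (s + 1)) * s <= s + e]; the denominator stays positive when
     [s = 0]. *)
  have [|d d0 md] := integrand_modulus M (e := e / (s + 1)).
    by rewrite divr_gt0.
  near=> n; rewrite peE.
  have h : C / n.+1%:R <= d.
    rewrite ler_pdivrMr// mulrC -ler_pdivrMr//.
    have : (Num.bound (C / d) <= n)%N by near: n; exact: nbhs_infty_ge.
    rewrite -(ler_nat R) => h; apply: le_trans (ltW (archi_boundP _)) _.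
      by rewrite divr_ge0// ltW.
    by apply: le_trans h _; rewrite ler_nat.
  apply: le_trans (WF n.+1 (e / (s + 1)) d isT _ h md) _.
    by rewrite divr_ge0// ltW.
  rewrite mulrDl mul1r lerD2l mulrAC ler_pdivrMr// ler_pM2l//; lra.
Unshelve. all: by end_near. Qed.

End existence.

End minimizers.

Theorem theorem1p2p1 (R : realType) (F : R * R -> R * R -> R)
  (Fcont : continuous (fun pq : (R * R) * (R * R) => F pq.1 pq.2))
  (Fconv : forall (p q1 q2 : R * R) (th : R), 0 <= th <= 1 ->
     F p (th * q1.1 + (1 - th) * q2.1, th * q1.2 + (1 - th) * q2.2)
       <= th * F p q1 + (1 - th) * F p q2)
  (Fhom : forall (p q : R * R) (l : R), 0 < l -> F p (l * q.1, l * q.2) = l * F p q)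
  (Fbnd : exists m1 m2 : R, [/\ 0 < m1, 0 < m2 &
     forall p q : R * R, m1 * enorm q <= F p q /\ F p q <= m2 * enorm q])
  (Fper : forall (p q : R * R) (n1 n2 : int), F (p.1 + n1%:~R, p.2 + n2%:~R) q = F p q) :
  forall tau : R, exists u v : R -> R * R,
    [/\ W11 u v, lipschitz2 u, Acal u v = tau%:E & Fcal F u v = SF F tau].
Proof.
case: Fbnd => m1 [m2 [m1_gt0 m2_gt0 {}Fbnd]] tau.
have S0 : (0 <= SF F tau)%E.
  apply: le_ereal_inf_tmp => _ [u [v [uv _ ->]]].
  by apply: integral_ge0 => t _; rewrite lee_fin; exact: (integrand_ge0 m1_gt0 Fbnd).
(* One competitor of finite energy makes the infimum a real number, which can then serve as [s]. *)
have Sfin : SF F tau \is a fin_num.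
  rewrite ge0_fin_numE//.
  have [u [v [uv A]]] := area_nonempty tau.
  apply: (@le_lt_trans _ _ (Fcal F u v)); first by apply: ereal_inf_lbound; exists u, v.
  by rewrite (Fcal_Rintegral Fcont m1_gt0 m2_gt0 Fbnd uv) ltry.
have SE : SF F tau = (fine (SF F tau))%:E by rewrite fineK.
have [||u [v [uv lip A E]]] :=
    @minimizer_exists R F Fcont Fconv Fhom m1 m2 m1_gt0 m2_gt0 Fbnd Fper tau (fine (SF F tau)).
- exact: fine_ge0.
- move=> e e0; have [x [u [v [uv A ->]]] lt] := lb_ereal_inf_adherent e0 Sfin.
  by exists u, v; split => //; rewrite EFinD -SE.
exists u, v; split => //; apply/eqP; rewrite eq_le; apply/andP; split.
  by rewrite SE.
by apply: ereal_inf_lbound; exists u, v.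
Qed.
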